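(* Let $(\Sigma,\rho,\mu)$ be a space of homogeneous type such that $\mathscr{B}_\rho$ (the family of all metric balls) satisfies the density condition. If $T$ is an $m$-linear $\omega$-Calder\'on--Zygmund operator with $\omega\in\mathrm{Dini}$, then $T$ is a multilinear bounded oscillation operator with respect to the ball-basis $\mathscr{B}_\rho^*$ and the exponent $r=1$, with constants $\mathfrak{C}_1(T)\le C\,C_K$ and $\mathfrak{C}_2(T)\le C'\,\|\omega\|_{\mathrm{Dini}}$, where $C$ depends only on $m$ and $\mu$, and $C'$ depends only on $m$, $\mu$ and $C_K$.
   Context: Space of homogeneous type: a metric space $(\Sigma,\rho)$ with a nonnegative Borel measure $\mu$ that is doubling, i.e. $0<\mu(2B)\le C_\mu\mu(B)<\infty$ for every ball $B$; $B(x,r)=\{y:\rho(x,y)<r\}$. $\mathscr{B}_\rho^*:=\mathscr{B}_\rho$ if $\mu(\Sigma)=\infty$ and $\mathscr{B}_\rho^*:=\mathscr{B}_\rho\cup\{\Sigma\}$ otherwise. Density condition: for every measurable $E$, almost every $x\in E$ is a density point, i.e. for every $\varepsilon>0$ there is a ball $B\ni x$ with $\mu(B\cap E)>(1-\varepsilon)\mu(B)$. Ball-basis: a family $\mathscr{B}$ of measurable sets such that (B1) $0<\mu(B)<\infty$ for $B\in\mathscr{B}$; (B2) any two points lie in a common $B\in\mathscr{B}$; (B3) for every $\varepsilon>0$ and measurable $E$ there is a finite or infinite sequence $\{B_k\}\subset\mathscr{B}$ with $\mu(E\Delta\bigcup_kB_k)<\varepsilon$; (B4) there is $\mathfrak{C}_0\ge1$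 and for each $B\in\mathscr{B}$ a set $B^*\in\mathscr{B}$ with $\mu(B^* )\le\mathfrak{C}_0\mu(B)$, $\bigcup\{B'\in\mathscr{B}:B'\cap B\ne\emptyset,\mu(B')\le2\mu(B)\}\subset B^*$, and $A\subset B\Rightarrow A^*\subset B^*$. It is known (Karagulyan) that under the density condition $\mathscr{B}_\rho^*$ is a ball-basis in which, for $B=B(x_0,r_0)$, one may take $B^*=B(x_0,R_0)$ with $2r_0\le R_0\le\infty$; this choice of $B^*$ is used. Bounded oscillation operator (scalar case). Put $\langle f\rangle_B:=\frac1{\mu(B)}\int_B|f|d\mu$, $\lfloor f\rfloor_B:=\sup_{B'\in\mathscr{B},B'\supset B}\langle f\rangle_{B'}$, $\vec f\mathbf{1}_E=(f_1\mathbf{1}_E,\ldots,f_m\mathbf{1}_E)$. An $m$-linear scalar-valued $T$ is a multilinear bounded oscillation operator with respect to $\mathscr{B}$ and $r=1$ with constants $\mathfrak{C}_1(T),\mathfrak{C}_2(T)\in(0,\infty)$ if: (T1) for every $B_0\in\mathscr{B}$ with $B_0^*\subsetneq\Sigma$ there is $B\in\mathscr{B}$, $B\supsetneq B_0$, such that for all $\vec f\in L^1(\Sigma,\mu)^m$, $\sup_{x\in B_0}|T(\vec f\mathbf{1}_{B^*})(x)-T(\vec f\mathbf{1}_{B_0^*})(x)|\le\mathfrak{C}_1(T)\prod_i\langle f_i\rangle_{B^*}$; (T2) for every $B\in\mathscr{B}$ and all such $\vec f$, $\sup_{x,x'\in B}|(T(\vec f)-T(\vec f\mathbf{1}_{B^*}))(x)-(T(\vec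 f)-T(\vec f\mathbf{1}_{B^*}))(x')|\le\mathfrak{C}_2(T)\prod_i\lfloor f_i\rfloor_B$. Moduli. $\omega:[0,\infty)\to[0,\infty)$ is a modulus of continuity if it is increasing, subadditive and $\omega(0)=0$; $\omega\in\mathrm{Dini}$ if $\|\omega\|_{\mathrm{Dini}}:=\int_0^1\omega(t)\frac{dt}t<\infty$. $\mathscr{C}^\alpha_b(\Sigma,\mu)$, $\alpha\in(0,1]$: functions with bounded support and $\|f\|_{L^\infty}+\sup_{x\ne y}\frac{|f(x)-f(y)|}{\rho(x,y)^\alpha}<\infty$. $\omega$-Calder\'on--Zygmund operators. $K:\Sigma^{m+1}\setminus\{x=y_1=\cdots=y_m\}\to\mathbb{C}$ is an $m$-linear $\omega$-Calder\'on--Zygmund kernel with constant $C_K>0$ if, writing $D(x,\vec y)=\big(\sum_{i=1}^m\mu(B(x,\rho(x,y_i)))\big)^m$ and $\Lambda=\max_{1\le i\le m}\rho(x,y_i)$: $|K(x,\vec y)|\le\frac{C_K}{D(x,\vec y)}$; $|K(x,\vec y)-K(x',\vec y)|\le\frac{C_K\,\omega(\rho(x,x')/\Lambda)}{D(x,\vec y)}$ whenever $\rho(x,x')\le\frac12\Lambda$; and for each $i$, $|K(x,\vec y)-K(x,\vec y')|\le\frac{C_K\,\omega(\rho(y_i,y_i')/\Lambda)}{D(x,\vec y)}$ whenever $\vec y'=(y_1,\ldots,y_i',\ldots,y_m)$ and $\rho(y_i,y_i')\le\frac12\Lambda$. An $m$-linear operator $T:\mathscr{C}_b^\alpha\times\cdots\times\mathscr{C}_b^\alpha\to(\mathscr{C}_b^\alpha)'$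 is an $\omega$-Calder\'on--Zygmund operator if for some such $K$, $T(\vec f)(x)=\int_{\Sigma^m}K(x,\vec y)f_1(y_1)\cdots f_m(y_m)\,d\mu(y_1)\cdots d\mu(y_m)$ whenever $x\notin\bigcap_i\operatorname{supp}(f_i)$ and $f_i\in\mathscr{C}_b^\alpha$, and $T$ is bounded from $L^{q_1}(\Sigma,\mu)\times\cdots\times L^{q_m}(\Sigma,\mu)$ to $L^q(\Sigma,\mu)$ for some $\frac1q=\sum\frac1{q_i}$ with $1<q_i<\infty$. (Such $T$ extends boundedly from $L^1\times\cdots\times L^1$ to $L^{1/m,\infty}$.) *)

(* Defs.v *)
From HB Require Import structures.
From mathcomp Require Import all_boot all_order all_algebra.
From mathcomp Require Import all_classical all_reals all_analysis.
From mathcomp Require Import complex.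

Set Implicit Arguments.
Unset Strict Implicit.
Unset Printing Implicit Defensive.

Import Order.TTheory GRing.Theory Num.Theory.
Import numFieldNormedType.Exports.

Local Open Scope classical_set_scope.
Local Open Scope ring_scope.

HB.mixin Record Metric_isBorel (d : measure_display) (K : numDomainType) (S : Type)
    of Measurable d S & Metric K S := {
  borel_measurableE : (measurable : set (set S)) = <<s [set A : set S | open A] >>
}.

#[short(type="borelMetricType")]
HB.structure Definition BorelMetric (d : measure_display) (K : numDomainType) :=
  { S of Measurable d S & Metric K S & Metric_isBorel d K S }.

Section complex_functions.
Context {d : measure_display} {T : measurableType d} {R : realType}.
Variable mu : {measure set T -> \bar R}.
Implicit Types f : T -> R[i].

Definition cabs (z : R[i]) : R := Normc.normc z.

Definition cmeasurable f :=
  measurable_fun setT (fun x => complex.Re (f x)) /\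
  measurable_fun setT (fun x => complex.Im (f x)).

Definition cintegrable f :=
  mu.-integrable setT (fun x => (complex.Re (f x))%:E) /\
  mu.-integrable setT (fun x => (complex.Im (f x))%:E).

Definition cintegral f : R[i] :=
  Complex (\int[mu]_x complex.Re (f x)) (\int[mu]_x complex.Im (f x)).

Definition restr0 f (E : set T) : T -> R[i] := patch (fun=> 0) E f.

Definition cLnorm (p : \bar R) f : \bar R := Lnorm mu p (fun x => (cabs (f x))%:E).

End complex_functions.

(* int ... int F(y_1, ..., y_m) dmu(y_m) ... dmu(y_1) *)
Fixpoint iter_cintegral {d : measure_display} {T : measurableType d} {R : realType}
    (mu : {measure set T -> \bar R}) (m : nat) : (m.-tuple T -> R[i]) -> R[i] :=
  match m return (m.-tuple T -> R[i]) -> R[i] with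
  | 0%N => fun F => F [tuple]
  | n.+1 => fun F =>
      cintegral mu (fun t => iter_cintegral mu (fun y : n.-tuple T => F [tuple of t :: y]))
  end.

Section homogeneous_type.
Context {d : measure_display} {R : realType} {S : borelMetricType d R}.
Variable mu : {measure set S -> \bar R}.
Local Open Scope ereal_scope.

Definition doubling (Cmu : R) :=
  forall (x : S) (r : R), (0 < r)%R ->
    [/\ 0 < mu (ball x (2 * r)%R),
        mu (ball x (2 * r)%R) <= Cmu%:E * mu (ball x r) &
        Cmu%:E * mu (ball x r) < +oo].

Definition balls : set (set S) :=
  [set B | exists x, exists2 r : R, (0 < r)%R & B = ball x r].

Definition balls_star : set (set S) :=
  [set B | balls B \/ (mu setT < +oo /\ B = setT)].

Definition density_condition (fam : set (set S)) :=
  forall E : set S, measurable E ->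
    {ae mu, forall x, E x -> forall e : R, (0 < e)%R ->
      exists B, [/\ fam B, B x & (1 - e)%:E * mu B < mu (B `&` E)]}.

Definition ball_basis (fam : set (set S)) (star : set S -> set S) (C0 : R) :=
  [/\ forall B, fam B -> [/\ measurable B, 0 < mu B & mu B < +oo],
      forall x y : S, exists B, [/\ fam B, B x & B y],
      forall (e : R) (E : set S), (0 < e)%R -> measurable E ->
        exists G : set (set S), [/\ countable G, G `<=` fam &
          mu (E `+` \bigcup_(B in G) B) < e%:E] &
      [/\ (1 <= C0)%R,
          forall B, fam B -> fam (star B) /\ mu (star B) <= C0%:E * mu B,
          forall B B', fam B -> fam B' -> B' `&` B !=set0 -> mu B' <= 2%:E * mu B ->
            B' `<=` star B &
          forall A B, fam A -> fam B -> A `<=` B -> star A `<=` star B]].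

(* The second alternative is B* = B(x0, R0) with R0 = +oo. *)
Definition concentric_star (star : set S -> set S) :=
  forall B, balls B -> exists (x0 : S) (r0 : R),
    [/\ (0 < r0)%R, B = ball x0 r0 &
        (exists2 R0 : R, (2 * r0 <= R0)%R & star B = ball x0 R0) \/ star B = setT].

Section bounded_oscillation.
Variables (fam : set (set S)) (star : set S -> set S).

Definition avg (f : S -> R[i]) (B : set S) : \bar R :=
  ((fine (mu B))^-1)%:E * \int[mu]_(x in B) (cabs (f x))%:E.

Definition sup_avg (f : S -> R[i]) (B : set S) : \bar R :=
  ereal_sup [set avg f B' | B' in [set B' | fam B' /\ B `<=` B']].

(* Operators on L^1 are maps on functions; all requirements are modulo null sets. *)
Definition L1_multilinear (m : nat) (T : ('I_m -> S -> R[i]) -> S -> R[i]) :=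
  (forall f, (forall i, cintegrable mu (f i)) -> cmeasurable (T f)) /\
  (forall f i (a : R[i]) (g h : S -> R[i]),
     (forall j, cintegrable mu (f j)) -> cintegrable mu g -> cintegrable mu h ->
     {ae mu, forall x,
       T (dfwith f i (fun y => a * g y + h y)%R) x =
         (a * T (dfwith f i g) x + T (dfwith f i h) x)%R}).

(* T f is defined modulo null sets only, so the suprema in (T1) and (T2) are
   essential ones. *)
Definition bounded_oscillation (m : nat) (C1 C2 : R)
    (T : ('I_m -> S -> R[i]) -> S -> R[i]) :=
  [/\ L1_multilinear T, (0 < C1)%R, (0 < C2)%R,
      forall B0, fam B0 -> star B0 `<` setT ->
        exists B, [/\ fam B, B0 `<` B &
          forall f, (forall i, cintegrable mu (f i)) ->
            {ae mu, forall x, B0 x ->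
              (cabs (T (fun i => restr0 (f i) (star B)) x
                     - T (fun i => restr0 (f i) (star B0)) x))%:E
              <= C1%:E * \prod_(i < m) avg (f i) (star B)}] &
      forall B, fam B -> forall f, (forall i, cintegrable mu (f i)) ->
        exists2 N, mu.-negligible N &
          forall x x', (B `\` N) x -> (B `\` N) x' ->
            (cabs ((T f x - T (fun i => restr0 (f i) (star B)) x)
                   - (T f x' - T (fun i => restr0 (f i) (star B)) x')))%:E
            <= C2%:E * \prod_(i < m) sup_avg (f i) B].

End bounded_oscillation.

Definition modulus_of_continuity (w : R -> R) :=
  [/\ w 0%R = 0%R,
      forall t, (0 <= t)%R -> (0 <= w t)%R,
      forall s t, (0 <= s)%R -> (s <= t)%R -> (w s <= w t)%R &
      forall s t, (0 <= s)%R -> (0 <= t)%R -> (w (s + t) <= w s + w t)%R].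

Definition dini_norm (w : R -> R) : \bar R :=
  \int[lebesgue_measure]_(t in `]0%R, 1%R]) (w t / t)%:E.

Section test_functions.
Variable alpha : R.

(* The pairs x = y contribute 0 / 0 = 0, so that the supremum is never -oo. *)
Definition holder_norm (f : S -> R[i]) : \bar R :=
  cLnorm mu +oo f +
  ereal_sup [set (cabs (f p.1 - f p.2) / mdist p.1 p.2 `^ alpha)%:E | p in [set: S * S]].

Definition Cb (f : S -> R[i]) :=
  (exists x (r : R), [set y | f y != 0%R] `<=` ball x r) /\ holder_norm f < +oo.

(* The dual of Cb, for the inductive limit topology of the spaces of functions
   supported in a fixed ball. *)
Definition Cb_dual (u : (S -> R[i]) -> R[i]) :=
  (forall (a : R[i]) g h, Cb g -> Cb h ->
     u (fun x => a * g x + h x)%R = (a * u g + u h)%R) /\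
  (forall x (r : R), exists A : R, forall g, Cb g ->
     [set y | g y != 0%R] `<=` ball x r -> (cabs (u g))%:E <= A%:E * holder_norm g).

Definition represents (F : S -> R[i]) (u : (S -> R[i]) -> R[i]) :=
  cmeasurable F /\
  forall g, Cb g -> cintegrable mu (fun x => F x * g x)%R /\
                    u g = cintegral mu (fun x => F x * g x)%R.

End test_functions.

Section calderon_zygmund.
Variable m : nat.

Definition csupp (f : S -> R[i]) : set S := closure [set x | f x != 0%R].

Definition CZ_denom (x : S) (y : 'I_m -> S) : R :=
  ((\sum_(i < m) fine (mu (ball x (mdist x (y i))))) ^+ m)%R.

Definition CZ_dist (x : S) (y : 'I_m -> S) : R :=
  (\big[Num.max/0]_(i < m) mdist x (y i))%R.

(* Only the values of K off the diagonal x = y_1 = ... = y_m matter. *)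
Definition CZ_kernel (w : R -> R) (CK : R) (K : S -> ('I_m -> S) -> R[i]) :=
  forall x y, ~ (forall i, y i = x) ->
  [/\ (cabs (K x y) <= CK / CZ_denom x y)%R,
      forall x', (mdist x x' <= 2^-1 * CZ_dist x y)%R ->
        (cabs (K x y - K x' y)
         <= CK * w (mdist x x' / CZ_dist x y) / CZ_denom x y)%R &
      forall i z, (mdist (y i) z <= 2^-1 * CZ_dist x y)%R ->
        (cabs (K x y - K x (dfwith y i z))
         <= CK * w (mdist (y i) z / CZ_dist x y) / CZ_denom x y)%R].

Definition CZ_operator (alpha : R) (w : R -> R) (CK : R)
    (T : ('I_m -> S -> R[i]) -> (S -> R[i]) -> R[i]) :=
  [/\ forall f, (forall i, Cb alpha (f i)) -> Cb_dual alpha (T f),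
      forall f i (a : R[i]) g h, (forall j, Cb alpha (f j)) -> Cb alpha g -> Cb alpha h ->
        forall phi, Cb alpha phi ->
        T (dfwith f i (fun x => a * g x + h x)%R) phi =
          (a * T (dfwith f i g) phi + T (dfwith f i h) phi)%R,
      exists2 K, CZ_kernel w CK K &
        forall f F, (forall i, Cb alpha (f i)) -> represents alpha F (T f) ->
        {ae mu, forall x, ~ (forall i, csupp (f i) x) ->
          F x = iter_cintegral mu (fun y : m.-tuple S =>
                  K x (tnth y) * \prod_(i < m) f i (tnth y i))%R} &
      exists q : 'I_m -> R, (forall i, (1 < q i)%R) /\
        exists A : R, forall f, (forall i, Cb alpha (f i)) ->
        exists2 F, represents alpha F (T f) &
          cLnorm mu ((\sum_(i < m) (q i)^-1)^-1)%R%:E F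
          <= A%:E * \prod_(i < m) cLnorm mu (q i)%:E (f i)].

(* The bounded extension of T from L^1 x ... x L^1 to L^{1/m, oo}. *)
Definition L1_extension (alpha : R) (T : ('I_m -> S -> R[i]) -> (S -> R[i]) -> R[i])
    (Text : ('I_m -> S -> R[i]) -> S -> R[i]) :=
  [/\ L1_multilinear Text,
      forall f, (forall i, Cb alpha (f i)) -> represents alpha (Text f) (T f) &
      exists A : R, forall f, (forall i, cintegrable mu (f i)) ->
        forall l : R, (0 < l)%R ->
        l%:E * (mu [set x | (l < cabs (Text f x))%R]) ^+ m
        <= A%:E * \prod_(i < m) cLnorm mu 1 (f i)].

End calderon_zygmund.
End homogeneous_type.

(* Main.v *)
Require Import Defs.
From mathcomp Require Import all_boot all_order all_algebra.
From mathcomp Require Import all_classical all_reals all_analysis.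
From mathcomp Require Import complex.
From mathcomp Require Import measurable_realfun ess_sup_inf.
From mathcomp Require Import ring lra.

(** * Calderon-Zygmund operators have bounded oscillation

    Both conditions compare [T f] with [T] applied to functions cut to a set
    [E = star B] containing the double of the ball [B = ball x0 r0]. Cutting the
    slots one after the other writes this difference as a sum of [m] terms
    ([telescope_slots]), in each of which one function vanishes on [E]. For such a
    term the kernel representation is available at the points of [B], and it remains
    to prove two estimates for an [m]-tuple [h] with [h i0 = 0] on the double of [B].

    The size estimate ([far_size]) bounds [T h] on [B]: the variable [y i0] stays at
    distance about [r0] from every point of [B], so the kernel is at most a constant
    times [CK] over the [m]-th power of the measure of [B].

    The oscillation estimate ([far_osc]) compares [T h x], for [x] in [B], with the
    kernel integral at the centre [x0] of [B]. Going through the centre is essential: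
    if [s < r0] bounds the distance from [x0] to [x] and [h i0] vanishes on
    [ball x0 (2 * s)], that distance is at most half of
    [max_i mdist x0 (y i)] on the support of the integrand, so that the regularity
    of the kernel always applies, whereas it may fail for two arbitrary points of
    [B]. On the annulus where the maximum is of order [2^k s] the difference of the
    kernels is at most [CK * w (2^-k)] over a power of the volume of
    [ball x0 (2^k s)]; integrating gives averages of [h i] over balls containing
    [B], each at most [sup_avg], with the coefficient [w (2^-k)], and these
    coefficients sum up to at most twice the Dini integral ([kernel_integrand_osc],
    [dyadic_sum_le_dini]).

    The representation is only given for test functions, so both estimates are
    first proved for Lipschitz functions with bounded support. For these the
    integrand is uniformly continuous in each variable, and iterated integrals are
    handled by induction on the number of variables ([iter_cintegral_le],
    [iter_cintegralB]). The estimates then pass to L1. Lipschitz functions are dense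
    in L1, even with the vanishing condition once the ball is slightly shrunk
    ([lip_dense_off_ball]). By the weak type inequality for the extended operator and
    the Borel-Cantelli lemma, approximants in one slot give convergence almost
    everywhere ([slot_converges_ae]), and both estimates are stable under such
    limits ([ae_bound_closure]), because their right-hand sides depend
    continuously on each function for the L1 norm.

    For the first condition the larger ball is the first dyadic dilate that is
    strictly larger than [B] as a set ([first_larger_ball]); its star has measure
    comparable to that of [B], which turns the size estimate into a product of
    averages. *)

Set Implicit Arguments.
Unset Strict Implicit.
Unset Printing Implicit Defensive.

Import Order.TTheory GRing.Theory Num.Theory.
Import numFieldNormedType.Exports.

Local Open Scope classical_set_scope.
Local Open Scope ring_scope.

(** * The modulus and integral of complex-valued functions *)

Section modulus.
Context {R : realType}.
Implicit Types (z : R[i]) (r : R).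

Lemma eq_ler r1 r2 : r1 = r2 -> r1 <= r2.
Proof. by move->. Qed.

Lemma cabs0 : cabs (0 : R[i]) = 0.
Proof. exact: Normc.normc0. Qed.

Lemma cabs_ge0 z : 0 <= cabs z.
Proof. by case: z => a b; exact: sqrtr_ge0. Qed.

Lemma cabsM z1 z2 : cabs (z1 * z2) = cabs z1 * cabs z2.
Proof. exact: Normc.normcM. Qed.

Lemma cabsN z : cabs (- z) = cabs z.
Proof. exact: (normcN z). Qed.

Lemma ler_cabsD z1 z2 : cabs (z1 + z2) <= cabs z1 + cabs z2.
Proof. exact: (le_normcD z1 z2). Qed.

Lemma cabs_distC z1 z2 : cabs (z1 - z2) = cabs (z2 - z1).
Proof. by rewrite -cabsN opprB. Qed.

Lemma ler_cabsB z1 z2 : cabs (z1 - z2) <= cabs z1 + cabs z2.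
Proof. by rewrite (le_trans (ler_cabsD _ _))// cabsN. Qed.

Lemma ler_cabs_dist z1 z2 z3 : cabs (z1 - z2) <= cabs (z1 - z3) + cabs (z3 - z2).
Proof. by rewrite -[z1 - z2](subrKA z3) ler_cabsD. Qed.

Lemma cabs_prod (I : Type) (s : seq I) (P : pred I) (F : I -> R[i]) :
  cabs (\prod_(i <- s | P i) F i) = \prod_(i <- s | P i) cabs (F i).
Proof. by apply: (big_morph _ cabsM); exact: Normc.normc1. Qed.

Lemma ler_cabs_sum (I : Type) (s : seq I) (P : pred I) (F : I -> R[i]) :
  cabs (\sum_(i <- s | P i) F i) <= \sum_(i <- s | P i) cabs (F i).
Proof.
elim/big_ind2 : _ => [|a b c e ab ce|//]; first by rewrite cabs0.
by rewrite (le_trans (ler_cabsD _ _))// lerD.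
Qed.

Lemma cabs_real r : cabs (Complex r 0) = `|r|.
Proof. by rewrite /cabs /= expr0n /= addr0 sqrtr_sqr. Qed.

Lemma cabs_imag r : cabs (Complex 0 r) = `|r|.
Proof. by rewrite /cabs /= expr0n /= add0r sqrtr_sqr. Qed.

Lemma Re_le_cabs z : `|complex.Re z| <= cabs z.
Proof. by case: z => a b /=; rewrite -sqrtr_sqr ler_wsqrtr// lerDl sqr_ge0. Qed.

Lemma Im_le_cabs z : `|complex.Im z| <= cabs z.
Proof. by case: z => a b /=; rewrite -sqrtr_sqr ler_wsqrtr// lerDr sqr_ge0. Qed.

Lemma cabs_le_ReIm z : cabs z <= `|complex.Re z| + `|complex.Im z|.
Proof.
have -> : z = Complex (complex.Re z) 0 + Complex 0 (complex.Im z).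
  by case: z => a b; apply/eqP; rewrite eq_complex /= addr0 add0r !eqxx.
by rewrite (le_trans (ler_cabsD _ _))// cabs_real cabs_imag /= addr0 add0r.
Qed.

Lemma ReD z1 z2 : complex.Re (z1 + z2) = complex.Re z1 + complex.Re z2.
Proof. by case: z1; case: z2. Qed.

Lemma ImD z1 z2 : complex.Im (z1 + z2) = complex.Im z1 + complex.Im z2.
Proof. by case: z1; case: z2. Qed.

Lemma ReN z : complex.Re (- z) = - complex.Re z.
Proof. by case: z. Qed.

Lemma ImN z : complex.Im (- z) = - complex.Im z.
Proof. by case: z. Qed.

End modulus.

Section complex_integral.
Context {d : measure_display} {T : measurableType d} {R : realType}.
Variable mu : {measure set T -> \bar R}.
Implicit Types f g : T -> R[i].

Lemma cmeasurable_cabs f : cmeasurable f -> measurable_fun setT (cabs \o f).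
Proof.
move=> [mr mi].
have -> : cabs \o f = fun x => Num.sqrt (complex.Re (f x) ^+ 2 + complex.Im (f x) ^+ 2).
  by apply/funext => x /=; case: (f x).
apply: (@measurableT_comp _ _ _ _ _ _ (@Num.sqrt R) _
  (fun x => complex.Re (f x) ^+ 2 + complex.Im (f x) ^+ 2)).
  by apply: continuous_measurable_fun; exact: sqrt_continuous.
by apply: measurable_funD; exact: measurable_funX.
Qed.

Lemma cintegrable_meas f : cintegrable mu f -> cmeasurable f.
Proof. by move=> [/measurable_int/measurable_EFinP ? /measurable_int/measurable_EFinP]. Qed.

Lemma le_cintegrable f (g : T -> R) : cmeasurable f ->
  mu.-integrable setT (EFin \o g) -> (forall x, cabs (f x) <= g x) -> cintegrable mu f.
Proof.
move=> [mr mi] ig fg; split; apply: (le_integrable measurableT _ _ ig) => //=.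
- exact/measurable_EFinP.
- by move=> x _ /=; rewrite lee_fin (le_trans (Re_le_cabs _))// (le_trans (fg x)) ?ler_norm.
- exact/measurable_EFinP.
- by move=> x _ /=; rewrite lee_fin (le_trans (Im_le_cabs _))// (le_trans (fg x)) ?ler_norm.
Qed.

Lemma cintegrable_cabs f : cintegrable mu f ->
  mu.-integrable setT (EFin \o (cabs \o f)).
Proof.
move=> cf; have [ir ii] := cf.
apply: (@le_integrable _ _ _ mu _ measurableT _
   ((EFin \o (fun x => `|complex.Re (f x)|)) \+ (EFin \o (fun x => `|complex.Im (f x)|)))).
- exact/measurable_EFinP/cmeasurable_cabs/cintegrable_meas.
- move=> x _ /=; rewrite lee_fin (ger0_norm (cabs_ge0 _)).
  by rewrite (le_trans (cabs_le_ReIm _))// ler_norm.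
- by apply: integrableD => //; exact: integrable_norm.
Qed.

Lemma eq_cintegrable f g : f =1 g -> cintegrable mu f -> cintegrable mu g.
Proof. by move=> /funext ->. Qed.

Lemma integrable_indic_lty (A : set T) : measurable A -> (mu A < +oo)%E ->
  mu.-integrable setT (EFin \o (\1_A : T -> R)).
Proof.
move=> mA Aoo; apply/integrableP; split.
  by apply/measurable_EFinP; exact: measurable_indic.
rewrite (eq_integral (fun x => (\1_A x)%:E)); last first.
  by move=> t _; rewrite gee0_abs// lee_fin.
by rewrite integral_indic// setIT.
Qed.

Lemma integrable_addr (f g : T -> R) : mu.-integrable setT (EFin \o f) ->
  mu.-integrable setT (EFin \o g) -> mu.-integrable setT (EFin \o (fun x => f x + g x)).
Proof.
move=> fi gi; have := integrableD measurableT fi gi.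
by congr (mu.-integrable _ _); apply/funext => x.
Qed.

Lemma integrable_subr (f g : T -> R) : mu.-integrable setT (EFin \o f) ->
  mu.-integrable setT (EFin \o g) -> mu.-integrable setT (EFin \o (fun x => f x - g x)).
Proof.
move=> fi gi; have := integrableB measurableT fi gi.
by congr (mu.-integrable _ _); apply/funext => x.
Qed.

Lemma integrable_mulr (k : R) (f : T -> R) : mu.-integrable setT (EFin \o f) ->
  mu.-integrable setT (EFin \o (fun x => k * f x)).
Proof.
move=> fi; have := integrableZl measurableT k fi.
by congr (mu.-integrable _ _); apply/funext => x.
Qed.

Lemma cintegrableD f g : cintegrable mu f -> cintegrable mu g ->
  cintegrable mu (fun x => f x + g x).
Proof.
move=> [fr fi] [gr gi]; split.
- have := integrable_addr fr gr; congr (mu.-integrable _ _).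
  by apply/funext => x /=; rewrite ReD.
- have := integrable_addr fi gi; congr (mu.-integrable _ _).
  by apply/funext => x /=; rewrite ImD.
Qed.

Lemma cintegrableB f g : cintegrable mu f -> cintegrable mu g ->
  cintegrable mu (fun x => f x - g x).
Proof.
move=> [fr fi] [gr gi]; split.
- have := integrable_subr fr gr; congr (mu.-integrable _ _).
  by apply/funext => x /=; rewrite ReD ReN.
- have := integrable_subr fi gi; congr (mu.-integrable _ _).
  by apply/funext => x /=; rewrite ImD ImN.
Qed.

Lemma restr0_cabs_le f E x : cabs (restr0 f E x) <= cabs (f x).
Proof. by rewrite /restr0 /patch; case: ifP; rewrite // cabs0 cabs_ge0. Qed.

Lemma restr0_in f E x : E x -> restr0 f E x = f x.
Proof. by move=> Ex; rewrite /restr0 /patch mem_set. Qed.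

Lemma restr0_out f E x : ~ E x -> restr0 f E x = 0.
Proof. by move=> Ex; rewrite /restr0 /patch memNset. Qed.

Lemma cintegrable_restr0 f E : measurable E -> cintegrable mu f ->
  cintegrable mu (restr0 f E).
Proof.
move=> mE cf; apply: (@le_cintegrable _ (cabs \o f)).
- have [mr mi] := cintegrable_meas cf; split.
  + rewrite (_ : (fun x => _) = (fun x => complex.Re (f x)) \_ E).
      apply/(measurable_restrictT _ mE); exact: measurable_funTS.
    by apply/funext => x; rewrite /restr0 /patch; case: ifP.
  + rewrite (_ : (fun x => _) = (fun x => complex.Im (f x)) \_ E).
      apply/(measurable_restrictT _ mE); exact: measurable_funTS.
    by apply/funext => x; rewrite /restr0 /patch; case: ifP.
- exact: cintegrable_cabs.
- by move=> x; exact: restr0_cabs_le.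
Qed.

Lemma cintegralB f g : cintegrable mu f -> cintegrable mu g ->
  cintegral mu (fun x => f x - g x) = cintegral mu f - cintegral mu g.
Proof.
move=> [fr fi] [gr gi]; rewrite /cintegral.
under eq_Rintegral do rewrite ReD ReN.
under [in X in Complex _ X]eq_Rintegral do rewrite ImD ImN.
by rewrite !RintegralB.
Qed.

(** The two parts of the integral are bounded separately. The factor 2 lost in this
    way spares choosing a rotation that makes the integral real, and it only enters
    the final constants. *)
Lemma cabs_cintegral_le f : cintegrable mu f ->
  cabs (cintegral mu f) <= 2 * \int[mu]_x cabs (f x).
Proof.
move=> cf; have [fr fi] := cf; rewrite (le_trans (cabs_le_ReIm _))//=.
have H (p : T -> R) : mu.-integrable setT (EFin \o p) -> (forall x, `|p x| <= cabs (f x)) ->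
    `|\int[mu]_x p x| <= \int[mu]_x cabs (f x).
  move=> ip pf; rewrite (le_trans (le_normr_Rintegral measurableT ip))//.
  apply: le_Rintegral => //; first exact: integrable_norm.
  exact: cintegrable_cabs.
rewrite mulrDl mul1r lerD// H// => x; [exact: Re_le_cabs|exact: Im_le_cabs].
Qed.

Definition l1norm f : R := \int[mu]_x cabs (f x).

Lemma l1norm_ge0 f : 0 <= l1norm f.
Proof. by apply: Rintegral_ge0 => x _; exact: cabs_ge0. Qed.

Lemma l1normE f : cintegrable mu f -> (\int[mu]_x (cabs (f x))%:E)%E = (l1norm f)%:E.
Proof.
by move=> /cintegrable_cabs cf; rewrite /l1norm /Rintegral fineK//; exact: integrable_fin_num.
Qed.

Lemma cLnorm1E f : cintegrable mu f -> cLnorm mu 1 f = (l1norm f)%:E.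
Proof.
move=> cf; rewrite /cLnorm Lnorm1 -l1normE//.
by apply: eq_integral => x _; rewrite gee0_abs// lee_fin cabs_ge0.
Qed.

Lemma le_l1norm f (g : T -> R) : cintegrable mu f -> mu.-integrable setT (EFin \o g) ->
  (forall x, cabs (f x) <= g x) -> l1norm f <= \int[mu]_x g x.
Proof. by move=> cf ig fg; apply: le_Rintegral => //; exact: cintegrable_cabs. Qed.

Lemma l1normD f g : cintegrable mu f -> cintegrable mu g ->
  l1norm (fun x => f x + g x) <= l1norm f + l1norm g.
Proof.
move=> cf cg; rewrite -RintegralD//; [|exact: cintegrable_cabs..].
apply: le_l1norm; first exact: cintegrableD.
  exact: integrable_addr (cintegrable_cabs cf) (cintegrable_cabs cg).
by move=> x; exact: ler_cabsD.
Qed.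

Lemma l1norm_distC f g : l1norm (fun x => f x - g x) = l1norm (fun x => g x - f x).
Proof. by apply: eq_Rintegral => x _; rewrite cabs_distC. Qed.

Lemma l1norm_triangle f g h : cintegrable mu f -> cintegrable mu g -> cintegrable mu h ->
  l1norm (fun x => f x - g x) <= l1norm (fun x => f x - h x) + l1norm (fun x => h x - g x).
Proof.
move=> cf cg ch; rewrite (le_trans _ (l1normD (cintegrableB cf ch) (cintegrableB ch cg)))//.
by apply: eq_ler; apply: eq_Rintegral => x _; rewrite subrKA.
Qed.

Lemma l1norm_sub f g : cintegrable mu f -> cintegrable mu g ->
  l1norm f <= l1norm g + l1norm (fun x => f x - g x).
Proof.
move=> cf cg; rewrite (le_trans _ (l1normD cg (cintegrableB cf cg)))//.
by apply: eq_ler; apply: eq_Rintegral => x _; rewrite addrC subrK.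
Qed.

End complex_integral.

(** * Iterated integrals of uniformly continuous functions *)

Section borel_metric.
Context {d : measure_display} {R : realType} {S : borelMetricType d R}.

Lemma ballP (x y : S) (r : R) : ball x r y <-> mdist x y < r.
Proof. by rewrite ballEmdist. Qed.

Lemma subset_ballr (x : S) (r s : R) : r <= s -> ball x r `<=` ball x s.
Proof. by move=> rs y /ballP xy; apply/ballP; exact: lt_le_trans rs. Qed.

Lemma open_mball (x : S) (r : R) : open (ball x r).
Proof.
rewrite openE => y /ballP xy; apply/nbhs_ballP.
exists (r - mdist x y); first by rewrite /= subr_gt0.
move=> z /ballP yz; apply/ballP.
by rewrite (le_lt_trans (metric_triangle x y z))// -ltrBrDl.
Qed.

Lemma open_measurable_borel (A : set S) : open A -> measurable A.
Proof. by move=> oA; rewrite borel_measurableE; exact: sub_sigma_algebra. Qed.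

Lemma measurable_mball (x : S) (r : R) : measurable (ball x r : set S).
Proof. exact/open_measurable_borel/open_mball. Qed.

Lemma metric_continuous_measurable (F : S -> R) :
  (forall x e, 0 < e -> exists2 dl, 0 < dl &
     forall y, mdist x y < dl -> `|F x - F y| < e) -> measurable_fun setT F.
Proof.
move=> cF; apply: (measurability _ (RGenOpens.measurableE R)) => _ [_ [a [b ->] <-]].
rewrite setTI; apply: open_measurable_borel.
rewrite openE => x /=; rewrite in_itv /= => /andP[ax xb].
have e0 : 0 < Num.min (F x - a) (b - F x) by rewrite lt_min !subr_gt0 ax.
have [dl dl0 Fd] := cF x _ e0.
apply/nbhs_ballP; exists dl => // y /ballP /Fd /=; rewrite in_itv /= lt_min.
by rewrite !ltr_norml => /andP[/andP[? ?] /andP[? ?]]; apply/andP; split; lra.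
Qed.

Variable mu : {measure set S -> \bar R}.
Hypothesis muballoo : forall (x : S) (r : R), (mu (ball x r) < +oo)%E.

Lemma integrable_indic_ball (x : S) (r : R) :
  mu.-integrable setT (EFin \o (\1_(ball x r) : S -> R)).
Proof. by apply: integrable_indic_lty; [exact: measurable_mball|exact: muballoo]. Qed.

Lemma integrable_sumr (I : Type) (s : seq I) (F : I -> S -> R) :
  (forall i, mu.-integrable setT (EFin \o F i)) ->
  mu.-integrable setT (EFin \o (fun x => \sum_(i <- s) F i x)).
Proof.
move=> iF; elim: s => [|i s IH].
  by under eq_fun do rewrite big_nil; exact: integrable0.
by under eq_fun do rewrite big_cons; exact: integrable_addr (iF i) IH.
Qed.

Lemma Rintegral_sumr (I : Type) (s : seq I) (F : I -> S -> R) :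
  (forall i, mu.-integrable setT (EFin \o F i)) ->
  \int[mu]_x (\sum_(i <- s) F i x) = \sum_(i <- s) \int[mu]_x F i x.
Proof.
move=> iF; elim: s => [|i s IH].
  by under eq_Rintegral do rewrite big_nil; rewrite big_nil Rintegral_cst// mul0r.
under eq_Rintegral do rewrite big_cons.
by rewrite big_cons RintegralD ?IH//; exact: integrable_sumr.
Qed.

(** The integrands [K(x, y) h_1(y_1) ... h_n(y_n)] met below are of this kind.
    Continuity is only asked one variable at a time, as a kernel provides it, but
    uniformly in the other variables: the inner integrals are then continuous in
    the outer variable, so that no joint measurability and no Fubini theorem are
    needed to handle iterated integrals. *)
Definition unif_cont_supported (n : nat) (x0 : S) (r M : R) (F : n.-tuple S -> R[i]) :=
  [/\ forall y, cabs (F y) <= M,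
      forall y i, ~ ball x0 r (tnth y i) -> F y = 0 &
      forall e, 0 < e -> exists2 dl, 0 < dl & forall y y' i,
        (forall j, j != i -> tnth y j = tnth y' j) -> mdist (tnth y i) (tnth y' i) < dl ->
        cabs (F y - F y') <= e].

Lemma unif_cont_supported_cons n x0 r M (F : n.+1.-tuple S -> R[i]) t :
  unif_cont_supported x0 r M F ->
  unif_cont_supported x0 r M (fun y : n.-tuple S => F [tuple of t :: y]).
Proof.
move=> [FM Fs Fc]; split=> [y|y i yi|e e0]; first exact: FM.
- by apply: (Fs _ (lift ord0 i)); rewrite tnthS.
- have [dl dl0 H] := Fc e e0; exists dl => // y y' i yy' di.
  apply: (H _ _ (lift ord0 i)); last by rewrite !tnthS.
  move=> j; case: (unliftP ord0 j) => [k ->|-> _]; last by rewrite !tnth0.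
  by rewrite !tnthS => /eqP ki; apply: yy'; apply: contra_notN ki => /eqP ->.
Qed.

Lemma unif_cont_supportedB n x0 r M M' (F G : n.-tuple S -> R[i]) :
  unif_cont_supported x0 r M F -> unif_cont_supported x0 r M' G ->
  unif_cont_supported x0 r (M + M') (fun y => F y - G y).
Proof.
move=> [FM Fs Fc] [GM Gs Gc]; split=> [y|y i yi|e e0].
- by rewrite (le_trans (ler_cabsB _ _))// lerD.
- by rewrite (Fs _ i yi) (Gs _ i yi) subr0.
- have e20 : 0 < e / 2 by rewrite divr_gt0.
  have [dF dF0 HF] := Fc _ e20; have [dG dG0 HG] := Gc _ e20.
  exists (Num.min dF dG); first by rewrite lt_min dF0.
  move=> y y' i yy'; rewrite lt_min => /andP[d1 d2].
  rewrite [_ - _](_ : _ = (F y - F y') - (G y - G y')); last by ring.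
  rewrite (le_trans (ler_cabsB _ _))// [leRHS]splitr lerD//; [exact: HF d1|exact: HG d2].
Qed.

(** Domination and linearity are proved together, by induction on the number of
    variables: in dimension [n], they say that the inner integral of an integrand of
    [n.+1] variables is a continuous, bounded function with bounded support, hence
    integrable, which is what the next step of both proofs requires. *)
Definition iter_bound n := forall x0 r M (F : n.-tuple S -> R[i]) N (c : 'I_N -> R)
    (phi : 'I_N -> 'I_n -> S -> R),
  unif_cont_supported x0 r M F ->
  (forall k, 0 <= c k) -> (forall k i x, 0 <= phi k i x) ->
  (forall k i, mu.-integrable setT (EFin \o phi k i)) ->
  (forall y, cabs (F y) <= \sum_k c k * \prod_i phi k i (tnth y i)) ->
  cabs (iter_cintegral mu F) <= 2 ^+ n * \sum_k c k * \prod_i \int[mu]_x phi k i x.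

Definition iter_sub n := forall x0 r M M' (F G : n.-tuple S -> R[i]),
  unif_cont_supported x0 r M F -> unif_cont_supported x0 r M' G ->
  iter_cintegral mu (fun y => F y - G y) = iter_cintegral mu F - iter_cintegral mu G.

(** If [F] varies by at most [e] when its first variable moves by less than [dl],
    its inner integral varies by at most [V * e], where [V] comes from integrating
    the indicator of the supporting ball in the other variables. *)
Lemma cintegrable_iter n x0 r M (F : n.+1.-tuple S -> R[i]) :
  iter_bound n -> iter_sub n -> unif_cont_supported x0 r M F ->
  cintegrable mu (fun t => iter_cintegral mu (fun y : n.-tuple S => F [tuple of t :: y])).
Proof.
move=> IA IB cF; have [FM Fs Fc] := cF.
pose V := 2 ^+ n * \prod_(i < n) \int[mu]_x (\1_(ball x0 r) x : R).
have V0 : 0 <= V.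
  by rewrite mulr_ge0// prodr_ge0// => i _; apply: Rintegral_ge0.
have bnd (G : n.-tuple S -> R[i]) M' e : 0 <= e -> unif_cont_supported x0 r M' G ->
    (forall y, cabs (G y) <= e) -> cabs (iter_cintegral mu G) <= V * e.
  move=> e0 cG Ge.
  have -> : V * e = 2 ^+ n * \sum_(k < 1) e * \prod_(i < n) \int[mu]_x (\1_(ball x0 r) x : R).
    by rewrite big_ord1 /V; ring.
  apply: (IA x0 r M' G 1%N (fun=> e) (fun _ _ => \1_(ball x0 r)) cG) => //.
    by move=> _ _; exact: integrable_indic_ball.
  move=> y; rewrite big_ord1.
  have [yb|/existsNP[i yi]] := pselect (forall i, ball x0 r (tnth y i)).
    by rewrite big1 ?mulr1// => i _; rewrite indicE mem_set.
  by case: cG => _ Gs _; rewrite (Gs _ _ yi) cabs0 mulr_ge0// prodr_ge0.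
have Fcons t := unif_cont_supported_cons t cF.
have contG t e : 0 < e -> exists2 dl, 0 < dl & forall t', mdist t t' < dl ->
    cabs (iter_cintegral mu (fun y : n.-tuple S => F [tuple of t :: y])
        - iter_cintegral mu (fun y : n.-tuple S => F [tuple of t' :: y])) < e.
  move=> e0; pose e' := e / (V + 1).
  have e'0 : 0 < e' by rewrite divr_gt0// ltr_wpDl.
  have [dl dl0 H] := Fc _ e'0; exists dl => // t' tt'.
  rewrite -(IB x0 r M M)//; apply: (@le_lt_trans _ _ (V * e')).
    apply: bnd (ltW e'0) (unif_cont_supportedB (Fcons t) (Fcons t')) _ => y.
    apply: (H _ _ ord0); last by rewrite !tnth0.
    by move=> j; case: (unliftP ord0 j) => [k ->|-> /eqP//]; rewrite !tnthS.
  by rewrite mulrCA gtr_pMr// ltr_pdivrMr ?mul1r ?ltrDl// ltr_wpDl.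
have M0 : 0 <= M by have := FM (nseq_tuple n.+1 x0); apply: le_trans; exact: cabs_ge0.
apply: (@le_cintegrable _ _ _ mu _ (fun t => V * M * \1_(ball x0 r) t)).
- split; apply: metric_continuous_measurable => t e e0;
    have [dl dl0 H] := contG t e e0; exists dl => // t' /H; apply: le_lt_trans.
  + by rewrite -ReN -ReD Re_le_cabs.
  + by rewrite -ImN -ImD Im_le_cabs.
- exact: integrable_mulr (integrable_indic_ball _ _).
- move=> t; rewrite -mulrA; apply: (bnd _ M _ _ (Fcons t)).
    by rewrite mulr_ge0.
  move=> y; rewrite indicE; have [tb|tb] := boolP (t \in _).
    by rewrite mulr1 FM.
  rewrite (Fs _ ord0) ?cabs0 ?mulr0// tnth0 => /mem_set.
  by rewrite (negbTE tb).
Qed.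

Lemma iter_boundS n : iter_bound n -> iter_sub n -> iter_bound n.+1.
Proof.
move=> IA IB x0 r M F N c phi cF c0 phi0 iphi Fphi /=.
have cI := cintegrable_iter IA IB cF.
rewrite (le_trans (cabs_cintegral_le cI))// exprS -mulrA ler_pM2l//.
pose a k := 2 ^+ n * (c k * \prod_i \int[mu]_x phi k (lift ord0 i) x).
apply: (@le_trans _ _ (\int[mu]_t (\sum_k a k * phi k ord0 t))).
  apply: le_Rintegral => //.
  - exact: cintegrable_cabs.
  - by apply: integrable_sumr => k; exact: integrable_mulr.
  move=> t _.
  have := IA x0 r M _ N (fun k => c k * phi k ord0 t) (fun k i => phi k (lift ord0 i))
    (unif_cont_supported_cons t cF).
  rewrite (_ : 2 ^+ n * _ = \sum_k a k * phi k ord0 t); last first.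
    by rewrite mulr_sumr; apply: eq_bigr => k _; rewrite /a; ring.
  apply => //; first by move=> k; rewrite mulr_ge0.
  move=> y; apply: (le_trans (Fphi _)); apply: ler_sum => k _.
  rewrite big_ord_recl tnth0 mulrA; apply: eq_ler; congr (_ * _).
  by apply: eq_bigr => i _; rewrite tnthS.
rewrite Rintegral_sumr; last by move=> k; exact: integrable_mulr.
rewrite mulr_sumr; apply: ler_sum => k _.
by rewrite RintegralZl// big_ord_recl /a; apply: eq_ler; ring.
Qed.

Lemma iter_subS n : iter_bound n -> iter_sub n -> iter_sub n.+1.
Proof.
move=> IA IB x0 r M M' F G cF cG /=.
rewrite -cintegralB; [|exact: cintegrable_iter cF|exact: cintegrable_iter cG].
congr (cintegral mu _); apply/funext => t.
exact: IB (unif_cont_supported_cons t cF) (unif_cont_supported_cons t cG).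
Qed.

Lemma iter_bound_sub n : iter_bound n /\ iter_sub n.
Proof.
elim: n => [|n [IA IB]]; last by split; [exact: iter_boundS|exact: iter_subS].
split=> [x0 r M F N c phi _ _ _ _ Fphi|//] /=.
rewrite expr0 mul1r (le_trans (Fphi _))//; apply: ler_sum => k _.
by rewrite !big_ord0.
Qed.

Lemma iter_cintegral_le n : iter_bound n.
Proof. by have [] := iter_bound_sub n. Qed.

Lemma iter_cintegralB n : iter_sub n.
Proof. by have [] := iter_bound_sub n. Qed.

End borel_metric.

(** * Dyadic sums of a Dini modulus *)

Section dini.
Context {R : realType}.
Variable w : R -> R.
Hypothesis modw : modulus_of_continuity w.
Hypothesis dini : (dini_norm w < +oo)%E.

Let D := fine (dini_norm w).

Let w0 t : 0 <= t -> 0 <= w t. Proof. by case: modw => _ + _ _; exact. Qed.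

Let wS s t : 0 <= s -> s <= t -> w s <= w t.
Proof. by case: modw => _ _ + _; exact. Qed.

Lemma dini_normE : dini_norm w = D%:E.
Proof.
rewrite fineK// ge0_fin_numE// integral_ge0// => t /=.
by rewrite in_itv /= lee_fin => /andP[t0 _]; rewrite divr_ge0 ?w0 ?ltW.
Qed.

Lemma dini_ge0 : 0 <= D.
Proof.
rewrite fine_ge0// integral_ge0// => t /=.
by rewrite in_itv /= lee_fin => /andP[t0 _]; rewrite divr_ge0 ?w0 ?ltW.
Qed.

Lemma measurable_dini : measurable_fun (`]0%R, 1%R] : set R) (fun t => w t / t).
Proof.
suff : measurable_fun (`]0%R, 1%R] : set R) (fun t => w (Num.max 0 t) * t `^ (-1)).
  apply: eq_measurable_fun => t; rewrite inE /= in_itv /= => /andP[t0 _].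
  by rewrite powR_inv1 ?ltW// max_r ?ltW.
apply: measurable_funM; last by apply: measurable_funTS; exact: measurable_powR.
apply: nondecreasing_measurable => // s t st.
apply: wS; first by rewrite comparable_le_max ?lexx// real_comparable.
by have [s0|s0] := leP 0 s; have [t0|t0] := leP 0 t; lra.
Qed.

(** Between [2^-(k+1)] and [2^-k] the integrand [w t / t] is at least
    [w (2^-(k+1)) / 2^-k]. This interval has length [2^-(k+1)], so it contributes at
    least [w (2^-(k+1)) / 2] to the Dini integral. *)
Lemma dyadic_sum_le_dini N : \sum_(k < N) w (2^-1 ^+ k.+1) <= 2 * D.
Proof.
pose I k : set R := [set` `]2^-1 ^+ k.+1, 2^-1 ^+ k] ].
have pw0 k : 0 < 2^-1 ^+ k :> R by rewrite exprn_gt0// invr_gt0.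
have h1 : 2^-1 <= 1 :> R by lra.
have pwS k : 2^-1 ^+ k.+1 <= 2^-1 ^+ k :> R by rewrite exprS ger_pMl.
pose c k := w (2^-1 ^+ k.+1) / 2^-1 ^+ k.
have mI k : measurable (I k) by exact: measurable_itv.
have mc k : measurable_fun (`]0%R, 1%R] : set R) (fun t => (c k)%:E * (\1_(I k) t)%:E)%E.
  by apply: emeasurable_funM => //; exact/measurable_EFinP/measurable_indic.
have muI k : lebesgue_measure (I k) = (2^-1 ^+ k.+1)%:E.
  rewrite lebesgue_measure_itv /= lte_fin ifT; last by rewrite exprS gtr_pMl//; lra.
  by rewrite -EFinD exprS; congr _%:E; field.
have c0 k : 0 <= c k by rewrite divr_ge0 ?w0 ?ltW.
have Idisj j k t : I j t -> I k t -> j = k.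
  have H a b : (a < b)%N -> I a t -> I b t -> False.
    move=> ab; rewrite /I /= !in_itv /= => /andP[at' _] /andP[_ tb].
    have : 2^-1 ^+ b <= 2^-1 ^+ a.+1 :> R.
      by rewrite ler_wiXn2l// ?invr_ge0.
    by move=> ba; have := lt_le_trans at' (le_trans tb ba); rewrite ltxx.
  by move=> Ij Ik; have [jk|kj|//] := ltngtP j k; [case: (H _ _ jk)|case: (H _ _ kj)].
have : (\int[lebesgue_measure]_(t in `]0%R, 1%R])
    (\sum_(k < N) (c k)%:E * (\1_(I k) t)%:E) <= dini_norm w)%E.
  apply: ge0_le_integral => //=.
  - by move=> t _; apply: sume_ge0 => k _; rewrite -EFinM lee_fin mulr_ge0.
  - by apply: emeasurable_sum => k; exact: mc.
  - by apply/measurable_EFinP; exact: measurable_dini.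
  move=> t; rewrite in_itv /= => /andP[t0 t1]; have [[k Ikt]|nI] := pselect (exists k : 'I_N, I k t).
    rewrite (bigD1 k)//= big1 ?adde0; last first.
      move=> j jk; rewrite indicE memNset ?mule0// => Ijt.
      by move/eqP : jk; apply; apply: val_inj; exact: Idisj Ijt Ikt.
    rewrite indicE mem_set// mule1 lee_fin /c.
    move: Ikt; rewrite /I /= in_itv /= => /andP[kt tk].
    apply: ler_pM.
    - exact: w0 (ltW (pw0 _)).
    - by rewrite invr_ge0 ltW.
    - exact: wS (ltW (pw0 _)) (ltW kt).
    - by rewrite lef_pV2 ?posrE.
  rewrite big1 ?lee_fin ?divr_ge0 ?w0 ?ltW// => k _.
  by rewrite indicE memNset ?mule0// => Ikt; apply: nI; exists k.
rewrite ge0_integral_sum//; first last.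
- by move=> k t _; rewrite -EFinM lee_fin mulr_ge0.
- by move=> k; exact: mc.
rewrite (eq_bigr (fun k : 'I_N => (2^-1 * w (2^-1 ^+ k.+1))%:E)); last first.
  move=> k _; rewrite integralZl//; last first.
    apply: (integrableS measurableT) => //; apply: integrable_indic_lty; first exact: mI.
    by rewrite [X in (X < _)%E]muI ltry.
  rewrite integral_indic; [|exact: measurable_itv|exact: mI]; rewrite setIidl; last first.
    move=> t; rewrite /I /= !in_itv /= => /andP[kt tk].
    rewrite (lt_trans (pw0 _) kt)/= (le_trans tk)//.
    by rewrite exprn_ile1// ?invr_ge0.
  rewrite [X in (_ * X)%E]muI -EFinM; congr _%:E; rewrite /c exprS.
  by have := lt0r_neq0 (pw0 k) => ?; field.
rewrite sumEFin dini_normE lee_fin -mulr_sumr => H.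
by rewrite -ler_pdivrMl.
Qed.

(** Otherwise all terms of the dyadic sums would be at least [e], and these sums
    would be unbounded. *)
Lemma dini_small e : 0 < e -> exists2 t, 0 < t & w t < e.
Proof.
move=> e0; apply: contrapT => H.
have we k : e <= w (2^-1 ^+ k).
  rewrite leNgt; apply/negP => wk; apply: H; exists (2^-1 ^+ k); last exact: wk.
  by rewrite exprn_gt0// invr_gt0.
have [n ne] : exists n : nat, 2 * D / e < n%:R.
  exists (Num.truncn (2 * D / e)).+1; rewrite truncnS_gt//.
have := dyadic_sum_le_dini n; apply/negP; rewrite -ltNge.
move: ne; rewrite ltr_pdivrMr// => /lt_le_trans; apply.
rewrite -[n in n%:R]card_ord -sum1_card natr_sum mulr_suml.
by apply: ler_sum => k _; rewrite mul1r.
Qed.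

(** Subadditivity propagates a zero of [w] to the whole half-line: if [w (1/2)]
    vanished, so would [w (n / 2)] for every [n]. *)
Lemma dini_gt0 : (exists2 t, 0 <= t & w t != 0) -> 0 < D.
Proof.
move=> [t t0 wt]; have wt0 : 0 < w t by rewrite lt_neqAle eq_sym wt w0.
suff w1 : 0 < w (2^-1 ^+ 1).
  have := dyadic_sum_le_dini 1; rewrite big_ord1 => /(lt_le_trans w1).
  by rewrite pmulr_rgt0.
have wn n s : 0 <= s -> w (s *+ n) <= w s *+ n.
  move=> s0; elim: n => [|n IH]; first by rewrite !mulr0n; case: modw => ->.
  rewrite !mulrS; case: modw => _ _ _ wD; rewrite (le_trans (wD _ _ _ _))//.
    exact: mulrn_wge0.
  by rewrite lerD2l.
rewrite lt_neqAle w0 ?exprn_ge0 ?invr_ge0// andbT; apply/negP => /eqP w12.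
have := wn (Num.truncn (2 * t)).+1 (2^-1 ^+ 1).
rewrite -w12 mul0rn exprn_ge0 ?invr_ge0// => /(_ isT); apply/negP; rewrite -ltNge.
rewrite (lt_le_trans wt0)//; apply: wS => //; rewrite expr1 -[_ *+ _.+1]mulr_natr.
by rewrite ler_pdivlMl// ltW// truncnS_gt.
Qed.

End dini.

(** * Kernel integrals of Lipschitz functions *)

Section volume.
Context {d : measure_display} {R : realType} {S : borelMetricType d R}.
Variables (mu : {measure set S -> \bar R}) (Cmu : R).
Hypothesis hmu : doubling mu Cmu.

Definition vol (x : S) (r : R) : R := fine (mu (ball x r)).

Lemma doubling_ball_lty x r : (mu (ball x r) < +oo)%E.
Proof.
have r0 : 0 < Num.max 1 r by rewrite lt_max ltr01.
have [_ h1 h2] := hmu x r0; apply: le_lt_trans (le_lt_trans h1 h2).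
apply: le_measure; rewrite ?inE; [exact: measurable_mball..|apply: subset_ballr].
by have [] := leP 1 r; lra.
Qed.

Lemma volE x r : mu (ball x r) = (vol x r)%:E.
Proof. by rewrite fineK// ge0_fin_numE// doubling_ball_lty. Qed.

Lemma vol_ge0 x r : 0 <= vol x r.
Proof. exact: fine_ge0. Qed.

Lemma vol_gt0 x r : 0 < r -> 0 < vol x r.
Proof.
move=> r0; have r20 : 0 < r / 2 by rewrite divr_gt0.
have [] := hmu x r20; rewrite (_ : 2 * (r / 2) = r); last by field.
by rewrite volE lte_fin.
Qed.

Lemma le_vol x y r s : ball x r `<=` ball y s -> vol x r <= vol y s.
Proof.
move=> xy; rewrite -lee_fin -!volE.
by apply: le_measure; rewrite ?inE//; exact: measurable_mball.
Qed.

Lemma vol_double x r : 0 < r -> vol x (2 * r) <= Cmu * vol x r.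
Proof. by move=> r0; have [_ + _] := hmu x r0; rewrite !volE -EFinM lee_fin. Qed.

Lemma doubling_cst_ge1 (x : S) : 1 <= Cmu.
Proof.
rewrite -(ler_pM2r (vol_gt0 x ltr01)) mul1r (le_trans _ (vol_double x ltr01))//.
by apply: le_vol; apply: subset_ballr; rewrite mulr1 ler1n.
Qed.

End volume.

Section lipschitz.
Context {d : measure_display} {R : realType} {S : borelMetricType d R}.

(** The same constant serves as a bound, a Lipschitz constant and a radius of the
    support: it can then be enlarged freely, for instance to serve a finite family. *)
Definition lip_on (A : R) (x0 : S) (h : S -> R[i]) :=
  [/\ forall x, cabs (h x) <= A,
      forall x y, cabs (h x - h y) <= A * mdist x y &
      forall x, ~ ball x0 A x -> h x = 0].

Definition lip_bounded (h : S -> R[i]) := exists x0 A, lip_on A x0 h.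

Lemma lip_bounded_recenter h (x1 : S) : lip_bounded h ->
  exists A0, forall A, A0 <= A -> lip_on A x1 h.
Proof.
move=> [x0 [B [hB hL hs]]]; exists (B + mdist x1 x0) => A BA.
have d0 : 0 <= mdist x1 x0 by exact: mdist_ge0.
have BA' : B <= A by lra.
split=> [x|x y|x xA]; first exact: le_trans BA'.
  by rewrite (le_trans (hL x y))// ler_wpM2r// mdist_ge0.
apply: hs => /ballP xB; apply: xA; apply/ballP.
have := metric_triangle x1 x0 x; lra.
Qed.

Lemma lip_family (m : nat) (h : 'I_m -> S -> R[i]) (x0 : S) :
  (forall i, lip_bounded (h i)) -> exists2 A, 1 <= A & forall i, lip_on A x0 (h i).
Proof.
move=> hl; have /choice[A0 hA0] := fun i => lip_bounded_recenter x0 (hl i).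
exists (\big[Num.max/1]_i A0 i); first exact: bigmax_ge_id.
by move=> i; apply: hA0; exact: le_bigmax.
Qed.

Variable mu : {measure set S -> \bar R}.
Hypothesis muballoo : forall (x : S) (r : R), (mu (ball x r) < +oo)%E.

Lemma lip_bounded_cintegrable h : lip_bounded h -> cintegrable mu h.
Proof.
move=> [x0 [A [hA hL hs]]].
have A0 : 0 <= A by exact: le_trans (cabs_ge0 _) (hA x0).
apply: (@le_cintegrable _ _ _ mu _ (fun x => A * \1_(ball x0 A) x)).
- have H x e : 0 < e -> exists2 dl, 0 < dl &
      forall y, mdist x y < dl -> cabs (h x - h y) < e.
    move=> e0; exists (e / (A + 1)); first by rewrite divr_gt0// ltr_wpDl.
    move=> y; rewrite ltr_pdivlMr ?ltr_wpDl// => xy.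
    by rewrite (le_lt_trans (hL x y))//; have := mdist_ge0 x y; lra.
  split; apply: metric_continuous_measurable => x e /(H x)[dl dl0 Hd];
    exists dl => // y /Hd; apply: le_lt_trans.
  + by rewrite -ReN -ReD Re_le_cabs.
  + by rewrite -ImN -ImD Im_le_cabs.
- exact: integrable_mulr (integrable_indic_ball muballoo _ _).
- move=> x; rewrite indicE; have [xA|xA] := boolP (x \in _); first by rewrite mulr1.
  by rewrite mulr0 hs ?cabs0// => /mem_set; rewrite (negbTE xA).
Qed.

End lipschitz.

Section kernel.
Context {d : measure_display} {R : realType} {S : borelMetricType d R}.
Variables (mu : {measure set S -> \bar R}) (Cmu : R).
Hypothesis hmu : doubling mu Cmu.
Variables (m : nat) (w : R -> R) (CK : R) (K : S -> ('I_m -> S) -> R[i]).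
Hypotheses (modw : modulus_of_continuity w) (dini : (dini_norm w < +oo)%E).
Hypotheses (CK0 : 0 < CK) (hK : CZ_kernel mu w CK K).

Let w0 t : 0 <= t -> 0 <= w t. Proof. by case: modw => _ + _ _; exact. Qed.

Let wS s t : 0 <= s -> s <= t -> w s <= w t.
Proof. by case: modw => _ _ + _; exact. Qed.

Lemma CZ_dist_ge (x : S) (y : 'I_m -> S) i : mdist x (y i) <= CZ_dist x y.
Proof. exact: le_bigmax. Qed.

Lemma CZ_denom_ge (x : S) (y : 'I_m -> S) i s : s <= mdist x (y i) ->
  vol mu x s ^+ m <= CZ_denom mu x y.
Proof.
move=> sxy; rewrite /CZ_denom lerXn2r ?nnegrE ?vol_ge0 ?sumr_ge0//.
rewrite (bigD1 i)//= ler_wpDr ?sumr_ge0//.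
by apply: (le_vol hmu); exact: subset_ballr.
Qed.

Lemma far_off_diagonal (x : S) (y : 'I_m -> S) i s : 0 < s -> s <= mdist x (y i) ->
  ~ (forall i, y i = x).
Proof. by move=> s0 + yx; rewrite yx mdistxx leNgt s0. Qed.

Lemma le_div_denom (x : S) (y : 'I_m -> S) i s c : 0 < s -> s <= mdist x (y i) -> 0 <= c ->
  c / CZ_denom mu x y <= c / vol mu x s ^+ m.
Proof.
move=> s0 sxy c0; apply: ler_wpM2l => //.
have v0 : 0 < vol mu x s ^+ m by rewrite exprn_gt0// (vol_gt0 hmu).
have vD := CZ_denom_ge sxy.
by rewrite lef_pV2 ?posrE// (lt_le_trans v0).
Qed.

Lemma kernel_size (x : S) (y : 'I_m -> S) i s : 0 < s -> s <= mdist x (y i) ->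
  cabs (K x y) <= CK / vol mu x s ^+ m.
Proof.
move=> s0 sxy; have [h _ _] := hK (far_off_diagonal s0 sxy).
by rewrite (le_trans h)// (le_div_denom s0 sxy)// ltW.
Qed.

Lemma kernel_slot (x : S) (y : 'I_m -> S) i j z s : 0 < s -> s <= mdist x (y i) ->
  mdist (y j) z <= s / 2 ->
  cabs (K x y - K x (dfwith y j z)) <= CK * w (mdist (y j) z / s) / vol mu x s ^+ m.
Proof.
move=> s0 sxy zs; have [_ _ h] := hK (far_off_diagonal s0 sxy).
have sL : s <= CZ_dist x y by rewrite (le_trans sxy)// CZ_dist_ge.
have d0 : 0 <= mdist (y j) z by exact: mdist_ge0.
have L0 : 0 < CZ_dist x y by exact: lt_le_trans sL.
rewrite (le_trans (h j z _)); [by []|lra|].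
apply: (@le_trans _ _ (CK * w (mdist (y j) z / s) / CZ_denom mu x y)); last first.
  by rewrite (le_div_denom s0 sxy)// mulr_ge0 ?w0 ?divr_ge0// ltW.
rewrite ler_wpM2r ?invr_ge0 ?exprn_ge0 ?sumr_ge0// ler_pM2l// wS//.
  by rewrite divr_ge0// ltW.
by rewrite ler_wpM2l// lef_pV2 ?posrE.
Qed.

Section integrand.
Variables (h : 'I_m -> S -> R[i]) (x1 : S) (A : R) (i0 : 'I_m).
Hypotheses (A1 : 1 <= A) (hA : forall i, lip_on A x1 (h i)).

(** The vanishing of [h i0] near [x], assumed in the lemmas below, keeps the
    integrand away from the singularity of the kernel. *)
Definition kernel_integrand (x : S) (y : m.-tuple S) : R[i] := K x (tnth y) * \prod_i h i (tnth y i).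

Let A0 : 0 <= A. Proof. exact: le_trans A1. Qed.

Let hbd i x : cabs (h i x) <= A. Proof. by have [] := hA i. Qed.

Lemma prod_le_lip (y : m.-tuple S) : cabs (\prod_i h i (tnth y i)) <= A ^+ m.
Proof.
rewrite cabs_prod -[X in _ <= A ^+ X](card_ord m) -prodr_const.
by apply: ler_prod => i _; rewrite cabs_ge0 hbd.
Qed.

Lemma prod_slot_lip (y y' : m.-tuple S) i :
  (forall j, j != i -> tnth y j = tnth y' j) ->
  cabs (\prod_i h i (tnth y i) - \prod_i h i (tnth y' i))
    <= A ^+ m * mdist (tnth y i) (tnth y' i).
Proof.
move=> yy'; rewrite (bigD1 i)//= [X in _ - X](bigD1 i)//=.
rewrite [X in _ - _ * X](eq_bigr (fun j => h j (tnth y j))); last by move=> j /yy' ->.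
have -> : A ^+ m = A * \prod_(j < m | j != i) A.
  by rewrite -[in LHS](card_ord m) -prodr_const (bigD1 i).
rewrite -mulrBl cabsM mulrAC.
apply: ler_pM; rewrite ?cabs_ge0//; first by have [_ + _] := hA i; apply.
by rewrite cabs_prod; apply: ler_prod => j _; rewrite cabs_ge0 hbd.
Qed.

(** Only [y] has to be far from [x]: as the two points differ by at most [s / 2],
    [y'] is then at distance at least [s / 2] from [x] and the size estimate applies
    to it. *)
Lemma kernel_integrand_slot (x : S) s (y y' : m.-tuple S) i : 0 < s -> s <= mdist x (tnth y i0) ->
  (forall j, j != i -> tnth y j = tnth y' j) ->
  mdist (tnth y i) (tnth y' i) <= s / 2 ->
  cabs (kernel_integrand x y - kernel_integrand x y') <=
    CK / vol mu x s ^+ m * A ^+ m * w (mdist (tnth y i) (tnth y' i) / s)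
  + CK / vol mu x (s / 2) ^+ m * A ^+ m * mdist (tnth y i) (tnth y' i).
Proof.
move=> s0 sxy yy' ds; have s20 : 0 < s / 2 by rewrite divr_gt0.
have y'E : tnth y' = dfwith (tnth y) i (tnth y' i).
  apply/funext => j; have [<-|ij] := eqVneq i j; first by rewrite dfwithin.
  by rewrite dfwithout// yy'// eq_sym.
have sxy' : s / 2 <= mdist x (tnth y' i0).
  have [ii0|ii0] := eqVneq i0 i; last by rewrite -yy'//; lra.
  move: ds; rewrite -ii0 => ds.
  by have := metric_triangle x (tnth y' i0) (tnth y i0); rewrite (metric_sym (tnth y' i0)); lra.
rewrite /kernel_integrand; set p := \prod_i _; set p' := \prod_i _.
rewrite (_ : _ - _ = (K x (tnth y) - K x (tnth y')) * p + K x (tnth y') * (p - p')); last by ring.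
rewrite (le_trans (ler_cabsD _ _))// !cabsM; apply: lerD.
  rewrite [leRHS]mulrAC; apply: ler_pM; rewrite ?cabs_ge0 ?prod_le_lip//.
  by rewrite [leRHS]mulrAC; have := kernel_slot s0 sxy ds; rewrite -y'E.
rewrite -[leRHS]mulrA; apply: ler_pM; rewrite ?cabs_ge0//; first exact: kernel_size sxy'.
exact: prod_slot_lip.
Qed.

Lemma kernel_integrand_far (x : S) s (y : m.-tuple S) : (forall z, mdist x z < s -> h i0 z = 0) ->
  kernel_integrand x y != 0 -> s <= mdist x (tnth y i0).
Proof.
move=> hs; rewrite leNgt; apply: contraNN => /hs hy.
by rewrite /kernel_integrand (bigD1 i0)//= hy mul0r mulr0.
Qed.

Lemma kernel_integrand_unif_cont_supported (x : S) s : 0 < s ->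
  (forall z, mdist x z < s -> h i0 z = 0) ->
  unif_cont_supported x1 A (CK / vol mu x s ^+ m * A ^+ m) (kernel_integrand x).
Proof.
move=> s0 hs; have s20 : 0 < s / 2 by rewrite divr_gt0.
have cst0 t : 0 < t -> 0 <= CK / vol mu x t ^+ m * A ^+ m.
  by move=> t0; rewrite mulr_ge0 ?divr_ge0 ?exprn_ge0 ?vol_ge0// ltW.
split=> [y|y i yi|e e0].
- have [->|/(kernel_integrand_far hs) sxy] := eqVneq (kernel_integrand x y) 0; first by rewrite cabs0 cst0.
  by rewrite cabsM ler_pM ?cabs_ge0 ?prod_le_lip//; exact: kernel_size sxy.
- have [_ _ hs'] := hA i.
  by rewrite /kernel_integrand (bigD1 i)//= hs'// mul0r mulr0.
- set B1 := CK / vol mu x s ^+ m * A ^+ m; set B2 := CK / vol mu x (s / 2) ^+ m * A ^+ m.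
  have B10 : 0 <= B1 by exact: cst0.
  have B20 : 0 <= B2 by exact: cst0.
  have e1 : 0 < e / 2 / (B1 + 1) by rewrite !divr_gt0// ltr_wpDl.
  have [t t0 wt] := dini_small modw dini e1.
  exists (Num.min (s / 2) (Num.min (s * t) (e / 2 / (B2 + 1)))).
    by rewrite !lt_min !divr_gt0 ?mulr_gt0// ltr_wpDl.
  have H y y' i : s <= mdist x (tnth y i0) ->
     (forall j, j != i -> tnth y j = tnth y' j) ->
     mdist (tnth y i) (tnth y' i) < Num.min (s / 2) (Num.min (s * t) (e / 2 / (B2 + 1))) ->
     cabs (kernel_integrand x y - kernel_integrand x y') <= e.
    move=> sxy yy'; rewrite !lt_min => /and3P[ds dt de].
    rewrite (le_trans (kernel_integrand_slot s0 sxy yy' (ltW ds)))// [leRHS]splitr lerD//.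
      rewrite (@le_trans _ _ (B1 * (e / 2 / (B1 + 1))))//.
        rewrite ler_wpM2l// (le_trans _ (ltW wt))// wS ?divr_ge0 ?mdist_ge0 ?(ltW s0)//.
        by rewrite ler_pdivrMr// mulrC ltW.
      by rewrite mulrCA ger_pMr ?divr_gt0// ler_pdivrMr ?ltr_wpDl// mul1r lerDl.
    rewrite (@le_trans _ _ (B2 * (e / 2 / (B2 + 1))))//.
      by rewrite ler_wpM2l// ltW.
    by rewrite mulrCA ger_pMr ?divr_gt0// ler_pdivrMr ?ltr_wpDl// mul1r lerDl.
  move=> y y' i yy' dyy'.
  have [y0|/(kernel_integrand_far hs) sxy] := eqVneq (kernel_integrand x y) 0; last exact: H dyy'.
  have [y'0|/(kernel_integrand_far hs) sxy'] := eqVneq (kernel_integrand x y') 0.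
    by rewrite y0 y'0 subrr cabs0 ltW.
  rewrite cabs_distC; apply: (H _ _ i) => //; last by rewrite metric_sym.
  by move=> j /yy' ->.
Qed.

Let muballoo := doubling_ball_lty hmu.

Let hint i : cintegrable mu (h i).
Proof. by apply: lip_bounded_cintegrable => //; exists x1, A. Qed.

Lemma kernel_integrand_iter_le (x : S) s : 0 < s -> (forall z, mdist x z < s -> h i0 z = 0) ->
  cabs (iter_cintegral mu (kernel_integrand x)) <= 2 ^+ m * (CK / vol mu x s ^+ m * \prod_i l1norm mu (h i)).
Proof.
move=> s0 hs.
have -> : CK / vol mu x s ^+ m * \prod_i l1norm mu (h i) =
   \sum_(k < 1) CK / vol mu x s ^+ m * \prod_i \int[mu]_x cabs (h i x) by rewrite big_ord1.
apply: (iter_cintegral_le muballoo (c := fun=> CK / vol mu x s ^+ m)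
  (phi := fun _ i => cabs \o h i) (kernel_integrand_unif_cont_supported s0 hs)).
- by move=> _; rewrite divr_ge0 ?exprn_ge0 ?vol_ge0// ltW.
- by move=> _ i y; exact: cabs_ge0.
- by move=> _ i; exact: cintegrable_cabs.
move=> y; rewrite big_ord1 -cabs_prod.
have [->|/(kernel_integrand_far hs) sxy] := eqVneq (kernel_integrand x y) 0.
  by rewrite cabs0 mulr_ge0 ?cabs_ge0// divr_ge0 ?exprn_ge0 ?vol_ge0// ltW.
by rewrite cabsM ler_wpM2r ?cabs_ge0//; exact: kernel_size sxy.
Qed.

Lemma CZ_dist_lt (x : S) (y : 'I_m -> S) a : 0 < a -> (forall i, mdist x (y i) < a) ->
  CZ_dist x y < a.
Proof. by move=> a0 ya; apply: bigmax_lt. Qed.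

Lemma CZ_dist_attained (x : S) (y : 'I_m -> S) a : 0 < a -> a <= CZ_dist x y ->
  exists i, a <= mdist x (y i).
Proof.
move=> a0; apply: contraPP => /forallNP H; apply/negP; rewrite -ltNge.
by apply: CZ_dist_lt => // i; rewrite ltNge; apply/negP.
Qed.

Lemma dyadic_scale N (L s : R) : 2 * s <= L -> L < 2 ^+ N.+1 * s ->
  exists k : 'I_N, 2 ^+ k.+1 * s <= L < 2 ^+ k.+2 * s.
Proof.
move=> sL; elim: N => [|N IH] LN; first by move: LN; rewrite expr1 ltNge sL.
have [LN'|LN'] := ltP L (2 ^+ N.+1 * s); last by exists ord_max; rewrite LN'.
by have [k Lk] := IH LN'; exists (widen_ord (leqnSn N) k).
Qed.

(** The comparison is made with the centre [x0], not with a second point of the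
    ball: as [mdist x0 x < s] and [h i0] vanishes on the ball of radius [2 * s]
    around [x0], the regularity of [K] in its first variable applies at every [y]
    in the support. It would not apply to two arbitrary points of the ball. *)
Lemma kernel_integrand_osc_dyadic (x0 x : S) s : 0 < s -> mdist x0 x < s ->
  (forall z, mdist x0 z < 2 * s -> h i0 z = 0) ->
  exists N, cabs (iter_cintegral mu (kernel_integrand x) - iter_cintegral mu (kernel_integrand x0)) <=
    2 ^+ m * \sum_(k < N) CK * w (2^-1 ^+ k.+1) / vol mu x0 (2 ^+ k.+1 * s) ^+ m *
       \prod_i \int[mu]_z (cabs (h i z) * \1_(ball x0 (2 ^+ k.+2 * s)) z).
Proof.
move=> s0 x0x hs0; have s20 : 0 < 2 * s by rewrite mulr_gt0.
have hs z : mdist x z < s -> h i0 z = 0.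
  by move=> xz; apply: hs0; have := metric_triangle x0 x z; lra.
pose N := (Num.truncn ((A + mdist x0 x1) / s)).+1; exists N.
(* All supports lie in the ball of radius [2^(N+1) s] around [x0], so that the
   scales from [2 s] on are exhausted by the first [N] dyadic annuli. *)
have AN : A + mdist x0 x1 < 2 ^+ N.+1 * s.
  rewrite -ltr_pdivrMr//; apply: (lt_trans (truncnS_gt _)).
  by rewrite -natrX ltr_nat (ltn_trans (ltn_expl N (ltnSn 1)))// ltn_exp2l.
have p2s k : 0 < 2 ^+ k * s by rewrite mulr_gt0// exprn_gt0.
have vp k : 0 < vol mu x0 (2 ^+ k * s) ^+ m by rewrite exprn_gt0// (vol_gt0 hmu).
have c0 k : 0 <= CK * w (2^-1 ^+ k.+1) / vol mu x0 (2 ^+ k.+1 * s) ^+ m.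
  by rewrite divr_ge0 ?mulr_ge0 ?w0 ?exprn_ge0 ?invr_ge0 ?vol_ge0// ltW.
have phi0 k i z : 0 <= cabs (h i z) * \1_(ball x0 (2 ^+ k * s)) z.
  by rewrite mulr_ge0 ?cabs_ge0.
rewrite -(iter_cintegralB muballoo (kernel_integrand_unif_cont_supported s0 hs)
                                   (kernel_integrand_unif_cont_supported s20 hs0)).
apply: (iter_cintegral_le muballoo
  (c := fun k => CK * w (2^-1 ^+ k.+1) / vol mu x0 (2 ^+ k.+1 * s) ^+ m)
  (phi := fun k i z => cabs (h i z) * \1_(ball x0 (2 ^+ k.+2 * s)) z)
  (unif_cont_supportedB (kernel_integrand_unif_cont_supported s0 hs)
                        (kernel_integrand_unif_cont_supported s20 hs0))) => //.
- move=> k i; have mB := @measurable_mball _ _ S x0 (2 ^+ k.+2 * s).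
  apply: (le_integrable measurableT _ _ (cintegrable_cabs (hint i))).
    apply/measurable_EFinP; apply: measurable_funM; last exact: measurable_indic.
    exact/cmeasurable_cabs/cintegrable_meas/hint.
  move=> z _; rewrite lee_fin /= !ger0_norm ?cabs_ge0//.
  by rewrite ler_piMr ?cabs_ge0// indicE; case: (_ \in _).
move=> y; rewrite /kernel_integrand -mulrBl.
have [->|p0] := eqVneq (\prod_i h i (tnth y i)) 0.
  by rewrite mulr0 cabs0 sumr_ge0// => k _; rewrite mulr_ge0// prodr_ge0.
have hy i : h i (tnth y i) != 0.
  by apply: contra_neq p0 => hi; rewrite (bigD1 i)//= hi mul0r.
have far : 2 * s <= mdist x0 (tnth y i0).
  by rewrite leNgt; apply: contra_neqN (hy i0) => /hs0.
have near_ i : mdist x0 (tnth y i) < 2 ^+ N.+1 * s.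
  apply: le_lt_trans AN; rewrite addrC (le_trans (metric_triangle x0 x1 _))// lerD2l.
  rewrite leNgt; apply/negP => yA; move/eqP: (hy i); apply.
  by have [_ _ hs'] := hA i; apply: hs' => /ballP; rewrite ltNge ltW.
have sL : 2 * s <= CZ_dist x0 (tnth y) by rewrite (le_trans far)// CZ_dist_ge.
have [k /andP[kL Lk]] := dyadic_scale sL (CZ_dist_lt (p2s _) near_).
rewrite (bigD1 k)//= ler_wpDr//.
  by apply: sumr_ge0 => j _; rewrite mulr_ge0// prodr_ge0.
rewrite cabsM cabs_prod.
have -> : \prod_i (cabs (h i (tnth y i)) * \1_(ball x0 (2 ^+ k.+2 * s)) (tnth y i))
    = \prod_i cabs (h i (tnth y i)).
  apply: eq_bigr => i _; rewrite indicE mem_set ?mulr1//; apply/ballP.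
  by rewrite (le_lt_trans (CZ_dist_ge _ _ _)).
rewrite ler_wpM2r ?prodr_ge0// => [i _|]; first exact: cabs_ge0.
have [_ reg _] := hK (far_off_diagonal s20 far).
rewrite cabs_distC (le_trans (reg x _))//; first lra.
have [i ki] := CZ_dist_attained (p2s _) kL.
have d0 := mdist_ge0 x0 x.
have L0 : 0 < CZ_dist x0 (tnth y) by exact: lt_le_trans sL.
apply: le_trans (le_div_denom (p2s _) ki _) _.
  by rewrite mulr_ge0 ?(ltW CK0)// w0// divr_ge0// ltW.
rewrite ler_wpM2r ?invr_ge0 ?(ltW (vp _))// ler_wpM2l ?(ltW CK0)// wS ?divr_ge0 ?(ltW L0)//.
rewrite ler_pdivrMr// exprVn mulrC ler_pdivlMr ?exprn_gt0// mulrC.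
by rewrite (le_trans _ kL)// ler_wpM2l ?exprn_ge0// ltW.
Qed.

(** [sg i] stands for the supremum of the averages of [h i] over large balls. By
    doubling, the volume at scale [2^(k+1) s] that controls the kernel may be
    replaced by the volume at scale [2^(k+2) s], over which [h i] is averaged; the
    dyadic sum of [w] is then all that remains. *)
Lemma kernel_integrand_osc (x0 x : S) s (sg : 'I_m -> R) : 0 < s -> mdist x0 x < s ->
  (forall z, mdist x0 z < 2 * s -> h i0 z = 0) ->
  (forall k i, \int[mu]_z (cabs (h i z) * \1_(ball x0 (2 ^+ k.+2 * s)) z)
                 <= sg i * vol mu x0 (2 ^+ k.+2 * s)) ->
  cabs (iter_cintegral mu (kernel_integrand x) - iter_cintegral mu (kernel_integrand x0)) <=
    2 ^+ m.+1 * CK * Cmu ^+ m * fine (dini_norm w) * \prod_i sg i.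
Proof.
move=> s0 x0x hs0 hsg; have [N HN] := kernel_integrand_osc_dyadic s0 x0x hs0.
apply: (le_trans HN); have Cmu1 := doubling_cst_ge1 hmu x0.
have p2s k : 0 < 2 ^+ k * s by rewrite mulr_gt0// exprn_gt0.
have vp k : 0 < vol mu x0 (2 ^+ k * s) by rewrite (vol_gt0 hmu).
have sg0 i : 0 <= sg i.
  rewrite -(pmulr_lge0 _ (vp 2%N)); apply: le_trans (hsg 0%N i).
  by apply: Rintegral_ge0 => z _; rewrite mulr_ge0 ?cabs_ge0.
rewrite exprS -!mulrA mulrCA ler_pM2l ?exprn_gt0//.
apply: (@le_trans _ _ (\sum_(k < N) CK * Cmu ^+ m * (\prod_i sg i) * w (2^-1 ^+ k.+1))).
  apply: ler_sum => k _.
  have -> : CK * Cmu ^+ m * (\prod_i sg i) * w (2^-1 ^+ k.+1) =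
     CK * w (2^-1 ^+ k.+1) / vol mu x0 (2 ^+ k.+1 * s) ^+ m *
     \prod_i (sg i * (Cmu * vol mu x0 (2 ^+ k.+1 * s))).
    rewrite big_split /= prodr_const card_ord exprMn.
    by have v0 := lt0r_neq0 (exprn_gt0 m (vp k.+1)); field.
  rewrite ler_wpM2l//.
    by rewrite divr_ge0 ?mulr_ge0 ?w0 ?exprn_ge0 ?invr_ge0 ?vol_ge0// ltW.
  apply: ler_prod => i _; apply/andP; split.
    by apply: Rintegral_ge0 => z _; rewrite mulr_ge0 ?cabs_ge0.
  rewrite (le_trans (hsg k i))// ler_wpM2l//.
  by rewrite exprS -mulrA (vol_double hmu).
rewrite -mulr_sumr.
have -> : 2 * (CK * (Cmu ^+ m * (fine (dini_norm w) * \prod_i sg i))) =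
  CK * Cmu ^+ m * (\prod_i sg i) * (2 * fine (dini_norm w)) by ring.
rewrite ler_wpM2l ?mulr_ge0 ?prodr_ge0 ?exprn_ge0 ?(ltW CK0)//.
  by rewrite (le_trans _ Cmu1).
exact: dyadic_sum_le_dini.
Qed.

End integrand.
End kernel.

(** * Density of Lipschitz functions in L1 *)

Section lip_closure.
Context {d : measure_display} {R : realType} {S : borelMetricType d R}.
Implicit Types f g : S -> R[i].

Lemma lip_bounded_cst_ge0 A (x0 : S) f : lip_on A x0 f -> 0 <= A.
Proof. by move=> [fA _ _]; exact: le_trans (cabs_ge0 _) (fA x0). Qed.

Lemma lip_boundedD f g : lip_bounded f -> lip_bounded g -> lip_bounded (fun x => f x + g x).
Proof.
move=> [x0 [A fA]] /(lip_bounded_recenter x0)[B gB]; exists x0.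
have [C [AC BC]] : exists C, A <= C /\ B <= C by exists (Num.max A B); rewrite !le_max !lexx orbT.
have A0 := lip_bounded_cst_ge0 fA; have [fA1 fA2 fA3] := fA; have [gC1 gC2 gC3] := gB C BC.
exists (C + C); split=> [x|x y|x xC].
- by rewrite (le_trans (ler_cabsD _ _))// lerD// (le_trans (fA1 x)).
- rewrite (_ : _ - _ = (f x - f y) + (g x - g y)); last by ring.
  rewrite (le_trans (ler_cabsD _ _))// mulrDl lerD// (le_trans (fA2 x y))//.
  by rewrite ler_wpM2r// mdist_ge0.
- have CC : C <= C + C by lra.
  have nC : ~ ball x0 C x by move=> xB; apply: xC; exact: subset_ballr CC _ xB.
  by rewrite fA3 ?gC3 ?addr0// => xB; apply: nC; exact: subset_ballr AC _ xB.
Qed.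

Lemma lip_boundedM f (g : S -> R[i]) (B : R) :
  lip_bounded f -> (forall x, cabs (g x) <= B) ->
  (forall x y, cabs (g x - g y) <= B * mdist x y) -> lip_bounded (fun x => g x * f x).
Proof.
move=> [x0 [A fA]] gB1 gB2; exists x0.
have A0 := lip_bounded_cst_ge0 fA; have [fA1 fA2 fA3] := fA.
have B0 : 0 <= B by exact: le_trans (cabs_ge0 _) (gB1 x0).
have AB : 0 <= A * B by rewrite mulr_ge0.
exists (A + 2 * (A * B)); split=> [x|x y|x xC].
- rewrite cabsM (@le_trans _ _ (B * A))//; last by lra.
  by rewrite ler_pM ?cabs_ge0.
- rewrite (_ : _ - _ = g x * (f x - f y) + (g x - g y) * f y); last by ring.
  rewrite (le_trans (ler_cabsD _ _))// !cabsM.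
  apply: (@le_trans _ _ (B * (A * mdist x y) + B * mdist x y * A)).
    by rewrite lerD// ler_pM ?cabs_ge0.
  rewrite [leRHS](_ : _ = B * (A * mdist x y) + B * mdist x y * A + A * mdist x y); last by ring.
  by rewrite lerDl mulr_ge0// mdist_ge0.
- have AC : A <= A + 2 * (A * B) by rewrite lerDl mulr_ge0.
  by rewrite fA3 ?mulr0// => xB; apply: xC; exact: subset_ballr AC _ xB.
Qed.

Lemma lip_boundedZ f c : lip_bounded f -> lip_bounded (fun x => c * f x).
Proof.
move=> fl; apply: (@lip_boundedM _ (fun=> c) (cabs c)) => // x y.
by rewrite subrr cabs0 mulr_ge0 ?cabs_ge0 ?mdist_ge0.
Qed.

Lemma lip_bounded0 (x0 : S) : lip_bounded (fun _ : S => 0 : R[i]).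
Proof. by exists x0, 0; split=> *; rewrite ?subrr ?cabs0 ?mul0r. Qed.

Variable mu : {measure set S -> \bar R}.
Hypothesis muballoo : forall (x : S) (r : R), (mu (ball x r) < +oo)%E.

Let lip_cint := lip_bounded_cintegrable muballoo.

Definition lip_approx f := cintegrable mu f /\
  forall e, 0 < e -> exists2 g, lip_bounded g & l1norm mu (fun x => f x - g x) <= e.

Lemma lip_approx_lip f : lip_bounded f -> lip_approx f.
Proof.
move=> fl; split; first exact: lip_cint.
move=> e e0; exists f => //; rewrite (_ : l1norm _ _ = 0) ?ltW//.
under [LHS]eq_Rintegral do rewrite subrr cabs0.
by rewrite Rintegral_cst// mul0r.
Qed.

Lemma cintegrableZ f c : cintegrable mu f -> cintegrable mu (fun x => c * f x).
Proof.
case: c => a b cf; have [fr fi] := cf; split.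
- have := integrable_subr (integrable_mulr a fr) (integrable_mulr b fi).
  by congr (mu.-integrable _ _); apply/funext => x /=; case: (f x).
- have := integrable_addr (integrable_mulr a fi) (integrable_mulr b fr).
  by congr (mu.-integrable _ _); apply/funext => x /=; case: (f x).
Qed.

Lemma l1normZ f c : cintegrable mu f -> l1norm mu (fun x => c * f x) = cabs c * l1norm mu f.
Proof.
move=> cf; rewrite /l1norm; under eq_Rintegral do rewrite cabsM.
by rewrite RintegralZl//; exact: cintegrable_cabs.
Qed.

Lemma lip_approxD f g : lip_approx f -> lip_approx g -> lip_approx (fun x => f x + g x).
Proof.
move=> [cf af] [cg ag]; split=> [|e e0]; first exact: cintegrableD.
have e20 : 0 < e / 2 by rewrite divr_gt0.
have [f' f'l ff'] := af _ e20; have [g' g'l gg'] := ag _ e20.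
exists (fun x => f' x + g' x); first exact: lip_boundedD.
rewrite [leRHS]splitr (le_trans _ (lerD ff' gg'))//.
have := l1normD (cintegrableB cf (lip_cint f'l)) (cintegrableB cg (lip_cint g'l)).
by apply: le_trans; apply: eq_ler; apply: eq_Rintegral => x _; congr cabs; ring.
Qed.

Lemma lip_approxZ f c : lip_approx f -> lip_approx (fun x => c * f x).
Proof.
move=> [cf af]; split=> [|e e0]; first exact: cintegrableZ.
have c0 : 0 < cabs c + 1 by rewrite ltr_wpDl// cabs_ge0.
have [g gl fg] := af (e / (cabs c + 1)) (divr_gt0 e0 c0).
exists (fun x => c * g x); first exact: lip_boundedZ.
have -> : l1norm mu (fun x => c * f x - c * g x) = cabs c * l1norm mu (fun x => f x - g x).
  rewrite -l1normZ; last exact: cintegrableB cf (lip_cint gl).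
  by apply: eq_Rintegral => x _; rewrite mulrBr.
rewrite (le_trans (ler_wpM2l (cabs_ge0 _) fg))// mulrCA ger_pMr// ler_pdivrMr//.
by rewrite mul1r lerDl.
Qed.

Lemma lip_approxB f g : lip_approx f -> lip_approx g -> lip_approx (fun x => f x - g x).
Proof.
move=> af /(lip_approxZ (-1)) ag; have := lip_approxD af ag.
by congr lip_approx; apply/funext => x; rewrite mulN1r.
Qed.

Lemma lip_approx_lim f : cintegrable mu f ->
  (forall e, 0 < e -> exists2 g, lip_approx g & l1norm mu (fun x => f x - g x) <= e) ->
  lip_approx f.
Proof.
move=> cf H; split=> // e e0; have e20 : 0 < e / 2 by rewrite divr_gt0.
have [g [cg ag] fg] := H _ e20; have [k kl gk] := ag _ e20.
exists k => //; rewrite (le_trans (l1norm_triangle cf (lip_cint kl) cg))//.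
by rewrite [leRHS]splitr lerD.
Qed.

Lemma l1_dominated (f_ : nat -> S -> R[i]) f (g : S -> R) :
  (forall n, cintegrable mu (f_ n)) -> cintegrable mu f ->
  mu.-integrable setT (EFin \o g) ->
  (forall n x, cabs (f x - f_ n x) <= g x) ->
  (forall x, exists N, forall n, (N <= n)%N -> f_ n x = f x) ->
  forall e, 0 < e -> exists n, l1norm mu (fun x => f x - f_ n x) <= e.
Proof.
move=> cf_ cf ig fg fN e e0.
pose u n x := (cabs (f x - f_ n x))%:E.
have cfB n := cintegrableB cf (cf_ n).
have [] := @dominated_convergence _ S R mu setT measurableT u (cst 0%E) (EFin \o g).
- by move=> n; exact: measurable_int (cintegrable_cabs (cfB n)).
- exact: measurable_cst.
- apply: aeW => x _; have [N HN] := fN x.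
  apply: cvg_near_cst; exists N => // n /= Nn.
  by rewrite /u HN// subrr cabs0.
- exact: ig.
- by apply: aeW => x n _; rewrite /u gee0_abs lee_fin ?cabs_ge0// fg.
move=> _ + _ => /fine_cvgP[_] /cvgrPdist_le /(_ e e0)[N _ /(_ N (leqnn N))] H.
exists N; move: H; rewrite /= sub0r normrN.
apply: le_trans; rewrite (le_trans (ler_norm _))//; apply: eq_ler; congr `|_|.
congr fine; apply: eq_integral => x _.
by rewrite /= subr0 ger0_norm ?cabs_ge0.
Qed.

Definition cind (E : set S) (x : S) : R[i] := Complex (\1_E x) 0.

Lemma cabs_cind_le1 E x : cabs (cind E x) <= 1.
Proof. by rewrite cabs_real indicE normr_nat; case: (_ \in _); rewrite ?ler01. Qed.

Lemma cintegrable_cind E : measurable E -> (mu E < +oo)%E -> cintegrable mu (cind E).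
Proof.
move=> mE Eoo; split; first exact: integrable_indic_lty.
exact: integrable0.
Qed.

(** The infimal convolution of the indicator of [W] with [n * mdist]. *)
Definition lip_minorant (W : set S) (n : nat) (x : S) : R :=
  inf [set \1_W y + n%:R * mdist x y | y in [set: S]].

Section minorant.
Variables (W : set S) (n : nat).
Let A x := [set \1_W y + n%:R * mdist x y | y in [set: S]].

Let A0 x : A x !=set0.
Proof. by exists (\1_W x + n%:R * mdist x x), x. Qed.

Let Alb x : lbound (A x) 0.
Proof. by move=> _ [y _ <-]; rewrite addr_ge0 ?mulr_ge0 ?mdist_ge0. Qed.

Let Ainf x : has_inf (A x).
Proof. by split; [exact: A0|exists 0; exact: Alb]. Qed.

Lemma lip_minorant_ge0 x : 0 <= lip_minorant W n x.
Proof. by apply: lb_le_inf; [exact: A0|exact: Alb]. Qed.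

Lemma lip_minorant_le x y : lip_minorant W n x <= \1_W y + n%:R * mdist x y.
Proof. by apply: ge_inf; [have [] := Ainf x|exists y]. Qed.

Lemma lip_minorant_indic x : lip_minorant W n x <= \1_W x.
Proof. by rewrite (le_trans (lip_minorant_le x x))// mdistxx mulr0 addr0. Qed.

Lemma lip_minorant_lip x y : lip_minorant W n x - lip_minorant W n y <= n%:R * mdist x y.
Proof.
rewrite lerBlDr addrC -lerBlDr; apply: lb_le_inf; first exact: A0.
move=> _ [z _ <-]; rewrite lerBlDr -addrA -mulrDr (le_trans (lip_minorant_le x z))//.
by rewrite lerD2l ler_wpM2l// addrC metric_triangle.
Qed.

Lemma lip_minorant_eq1 x e : 0 < e -> ball x e `<=` W -> 1 <= n%:R * e ->
  lip_minorant W n x = 1.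
Proof.
move=> e0 xW ne; apply/eqP; rewrite eq_le; apply/andP; split.
  by rewrite (le_trans (lip_minorant_indic x))// indicE; case: (_ \in _); rewrite ?ler01.
apply: lb_le_inf; first exact: A0.
move=> _ [y _ <-]; have [xy|xy] := ltP (mdist x y) e.
  by rewrite indicE mem_set ?lerDl ?mulr_ge0 ?mdist_ge0//; exact/xW/ballP.
by rewrite (le_trans ne)// ler_wpDl// ler_wpM2l.
Qed.

End minorant.

(** The infimal convolutions increase to the indicator of an open set, since every
    point of it is the centre of a ball on which the indicator is 1. *)
Lemma lip_approx_open (U : set S) (x0 : S) (r : R) : open U ->
  lip_approx (cind (U `&` ball x0 r)).
Proof.
move=> oU; set W := U `&` _.
have oW : open W by apply: openI => //; exact: open_mball.
have mW : measurable W by exact: open_measurable_borel.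
have Woo : (mu W < +oo)%E.
  apply: le_lt_trans (muballoo x0 r); apply: le_measure; rewrite ?inE//.
  - exact: measurable_mball.
  - exact: subIsetr.
have cW := cintegrable_cind mW Woo.
pose f_ n x : R[i] := Complex (lip_minorant W n x) 0.
have lf n : lip_bounded (f_ n).
  exists x0, (Num.max (Num.max 1 r) n%:R).
  have [m1 mr mn] : [/\ 1 <= Num.max (Num.max 1 r) n%:R, r <= Num.max (Num.max 1 r) n%:R &
      n%:R <= Num.max (Num.max 1 r) n%:R].
    by split; rewrite !le_max lexx ?orbT.
  split=> [x|x y|x xr].
  - rewrite cabs_real ger0_norm ?lip_minorant_ge0// (le_trans _ m1)//.
    by rewrite (le_trans (lip_minorant_indic _ _ _))// indicE; case: (_ \in _); rewrite ?ler01.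
  - have -> : f_ n x - f_ n y = Complex (lip_minorant W n x - lip_minorant W n y) 0.
      by apply/eqP; rewrite eq_complex /= subr0 !eqxx.
    rewrite cabs_real (@le_trans _ _ (n%:R * mdist x y))//.
      rewrite ler_norml lip_minorant_lip andbT lerNl opprB metric_sym.
      exact: lip_minorant_lip.
    by rewrite ler_wpM2r// mdist_ge0.
  - have : lip_minorant W n x <= 0.
      rewrite (le_trans (lip_minorant_indic _ _ _))// indicE memNset// => -[_ xW].
      by apply: xr; move: xW; exact: subset_ballr.
    by rewrite /f_ => h; congr Complex; apply/eqP; rewrite eq_le h lip_minorant_ge0.
apply: lip_approx_lim => // e e0.
have [||||n Hn] := @l1_dominated f_ (cind W) (fun x => \1_W x) _ cW _ _ _ e e0.
- by move=> n; exact: lip_cint.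
- exact: integrable_indic_lty.
- move=> n x; rewrite /cind /f_.
  rewrite (_ : _ - _ = Complex (\1_W x - lip_minorant W n x) 0); last first.
    by apply/eqP; rewrite eq_complex /= subr0 !eqxx.
  rewrite cabs_real ger0_norm ?subr_ge0 ?lip_minorant_indic//.
  by rewrite lerBlDr lerDl lip_minorant_ge0.
- move=> x; have [Wx|Wx] := pselect (W x); last first.
    exists 0%N => n _; rewrite /cind indicE memNset//; congr Complex.
    apply/eqP; rewrite eq_le lip_minorant_ge0 andbT.
    by rewrite (le_trans (lip_minorant_indic _ _ _))// indicE memNset.
  have /nbhs_ballP[eps /= eps0 xW] : nbhs x W by exact: open_nbhs_nbhs.
  exists (Num.truncn eps^-1).+1 => n Nn; rewrite /f_ /cind indicE mem_set//.
  rewrite (lip_minorant_eq1 eps0 xW)// -ler_pdivrMr// mul1r ltW//.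
  by rewrite (lt_le_trans (truncnS_gt _))// ler_nat.
- by exists (f_ n) => //; exact: lip_approx_lip.
Qed.

(** Inside a fixed ball, the Borel sets whose indicator is approximable form a
    Dynkin class, and this class contains the open sets, which are stable under
    intersection and generate the Borel sets. *)
Lemma lip_approx_borel (E : set S) (x0 : S) (r : R) : measurable E ->
  lip_approx (cind (E `&` ball x0 r)).
Proof.
have mB := @measurable_mball _ _ S x0 r.
have cB A : measurable A -> cintegrable mu (cind (A `&` ball x0 r)).
  move=> mA; apply: cintegrable_cind; first exact: measurableI.
  by apply: le_lt_trans (measureIr _ _ _) (muballoo x0 r).
rewrite borel_measurableE; move: E.
apply: (@dynkin_induction _ S [set A | open A]
  (fun A => lip_approx (cind (A `&` ball x0 r)))).
- exact: borel_measurableE.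
- by move=> A B; exact: openI.
- by apply: lip_approx_open; exact: openT.
- by move=> U oU; exact: lip_approx_open.
- move=> E mE aE; have := lip_approxB (lip_approx_open x0 r openT) aE.
  congr lip_approx; apply/funext => x; rewrite /cind setTI.
  apply/eqP; rewrite eq_complex /= oppr0 addr0 eqxx andbT; apply/eqP.
  rewrite !indicE !in_setI in_setC.
  by case: (x \in E); case: (x \in (ball x0 r : set S)); rewrite /= ?subrr ?subr0.
move=> F mF tF aF; set E := \bigcup_k F k.
pose G n : set S := \bigcup_(k < n) F k.
have mG n : measurable (G n) by exact: bigcup_measurable.
have aG n : lip_approx (cind (G n `&` ball x0 r)).
  elim: n => [|n IH].
    have := lip_approx_lip (lip_bounded0 x0); congr lip_approx.
    apply/funext => x; rewrite /cind /G bigcup_mkord big_ord0 set0I.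
    by rewrite indicE in_set0.
  have := lip_approxD IH (aF n); congr lip_approx; apply/funext => x.
  apply/eqP; rewrite eq_complex /= addr0 eqxx andbT; apply/eqP.
  have disj : G n x -> F n x -> False.
    move=> [k /= kn Fkx] Fnx; have := tF k n I I; move=> H.
    have kn' : k = n by apply: H; exists x.
    by rewrite kn' ltnn in kn.
  have GS : G n.+1 x <-> G n x \/ F n x.
    split=> [[k /= kn Fkx]|[[k /= kn Fkx]|Fnx]].
    - by move: kn; rewrite ltnS leq_eqVlt => /predU1P[<-|kn]; [right|left; exists k].
    - by exists k => //=; rewrite ltnS ltnW.
    - by exists n => /=.
  rewrite !indicE !in_setI; case: (x \in (ball x0 r : set S)); rewrite ?andbF ?andbT ?addr0//.
  have -> : (x \in G n.+1) = (x \in G n) || (x \in F n).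
    apply/idP/orP; rewrite !inE; first by move/GS.
    by move=> ?; apply/GS.
  have [Gx|] := boolP (x \in G n); have [Fx|] := boolP (x \in F n) => //=.
  - by case: disj; exact/set_mem.
  - by rewrite addr0.
  - by rewrite add0r.
  - by rewrite addr0.
have mE : measurable E by exact: bigcup_measurable.
apply: lip_approx_lim => [|e e0]; first exact: cB.
have [||||n Hn] := @l1_dominated (fun n => cind (G n `&` ball x0 r))
   (cind (E `&` ball x0 r)) (fun x => 2 * \1_(ball x0 r) x) _ (cB _ mE) _ _ _ e e0.
- by move=> n; exact: cB.
- by apply: integrable_mulr; exact: integrable_indic_lty.
- move=> n x; have [xB|xB] := boolP (x \in (ball x0 r : set S)).
    rewrite indicE xB mulr1 (le_trans (ler_cabsB _ _))//.
    by have := cabs_cind_le1 (E `&` ball x0 r) x; have := cabs_cind_le1 (G n `&` ball x0 r) x; lra.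
  by rewrite /cind !indicE !in_setI (negbTE xB) !andbF subrr cabs0 mulr0.
- move=> x; have [[k _ Fkx]|nE] := pselect (E x).
    exists k.+1 => n kn; rewrite /cind !indicE !in_setI.
    rewrite [x \in G n]mem_set; last by exists k.
    by rewrite [x \in E]mem_set//; exists k.
  exists 0%N => n _; rewrite /cind !indicE !in_setI.
  rewrite [x \in G n]memNset; last by move=> [k /= _ Fkx]; apply: nE; exists k.
  by rewrite [x \in E]memNset.
- by exists (cind (G n `&` ball x0 r)).
Qed.

Lemma lip_approx_indic (E : set S) (x0 : S) : measurable E -> (mu E < +oo)%E ->
  lip_approx (cind E).
Proof.
move=> mE Eoo; have cE := cintegrable_cind mE Eoo.
have mEB n : measurable (E `&` ball x0 n%:R) by exact: measurableI (measurable_mball _ _).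
apply: lip_approx_lim => // e e0.
have [||||n Hn] := @l1_dominated (fun n => cind (E `&` ball x0 n%:R))
   (cind E) (fun x => 2 * \1_E x) _ cE _ _ _ e e0.
- move=> n; apply: cintegrable_cind => //.
  by apply: le_lt_trans Eoo; apply: le_measure; rewrite ?inE//; exact: subIsetl.
- by apply: integrable_mulr; exact: integrable_indic_lty.
- move=> n x; have [xE|xE] := boolP (x \in E).
    rewrite indicE xE mulr1 (le_trans (ler_cabsB _ _))//.
    by have := cabs_cind_le1 E x; have := cabs_cind_le1 (E `&` ball x0 n%:R) x; lra.
  by rewrite /cind !indicE !in_setI (negbTE xE) andFb subrr cabs0 mulr0.
- move=> x; exists (Num.truncn (mdist x0 x)).+1 => n Nn.
  rewrite /cind !indicE !in_setI [x \in (ball _ _ : set S)]mem_set ?andbT//.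
  apply/ballP; rewrite (lt_le_trans (truncnS_gt _))// ler_nat//.
- by exists (cind (E `&` ball x0 n%:R)) => //; exact: lip_approx_borel.
Qed.

Lemma lip_approx_sum (I : Type) (s : seq I) (F : I -> S -> R[i]) (x0 : S) :
  (forall i, lip_approx (F i)) -> lip_approx (fun x => \sum_(i <- s) F i x).
Proof.
move=> aF; elim: s => [|i s IH].
  have := lip_approx_lip (lip_bounded0 x0); congr lip_approx.
  by apply/funext => x; rewrite big_nil.
by have := lip_approxD (aF i) IH; congr lip_approx; apply/funext => x; rewrite big_cons.
Qed.

Import HBSimple.

Lemma lip_approx_simple (g : {sfun S >-> R}) (x0 : S) :
  mu.-integrable setT (EFin \o g) -> lip_approx (fun x => Complex (g x) 0).
Proof.
move=> ig.
have aE (r : R) : lip_approx (fun x => Complex r 0 * cind (g @^-1` [set r]) x).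
  have [->|r0] := eqVneq r 0.
    have := lip_approx_lip (lip_bounded0 x0); congr lip_approx.
    by apply/funext => x; rewrite mul0r.
  have mE : measurable (g @^-1` [set r]).
    by rewrite -[X in measurable X]setTI; exact: measurable_funPT.
  apply: lip_approxZ; apply: (lip_approx_indic x0) => //.
  have ir : mu.-integrable setT (EFin \o (\1_(g @^-1` [set r]) : S -> R)).
    apply: (le_integrable measurableT _ _ (integrable_mulr (`|r|^-1) (integrable_norm ig))).
      by apply/measurable_EFinP; exact: measurable_indic.
    move=> x _; rewrite /= lee_fin indicE; have [xr|xr] := boolP (x \in _).
      by move: xr; rewrite inE /= => ->; rewrite mulVf ?normr_eq0// normr1.
    by rewrite normr0.
  move/integrableP : ir => [_]; rewrite (eq_integral (fun x => (\1_(g @^-1` [set r]) x)%:E)).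
    by rewrite integral_indic// setIT.
  by move=> x _; rewrite gee0_abs// lee_fin.
have := @lip_approx_sum _ (finmap.enum_fset (fset_set (range g)))
  (fun r x => Complex r 0 * cind (g @^-1` [set r]) x) x0 aE.
congr lip_approx; apply/funext => x; rewrite [in RHS]fimfunE fsbig_finite//=.
elim/big_ind2 : _ => [//|z1 z2 z3 z4 -> ->|i _].
  by apply/eqP; rewrite eq_complex /= addr0 !eqxx.
by apply/eqP; rewrite eq_complex /= !mulr0 mul0r subr0 addr0 !eqxx.
Qed.

Lemma lip_approx_real (g : S -> R) (x0 : S) :
  mu.-integrable setT (EFin \o g) -> lip_approx (fun x => Complex (g x) 0).
Proof.
move=> ig; apply: lip_approx_lim => [|e e0].
  by split=> //; exact: integrable0.
have [s_ [is_ _ /fine_cvgP[_] /cvgrPdist_le /(_ e e0)[N _ /(_ N (leqnn N))]]] :=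
  approximation_sfun_integrable measurableT ig.
rewrite /= sub0r normrN => sN.
exists (fun x => Complex (s_ N x) 0); first exact: lip_approx_simple.
apply: le_trans sN; rewrite (le_trans _ (ler_norm _))//; apply: eq_ler.
congr fine; apply: eq_integral => x _; rewrite (_ : _ - _ = Complex (g x - s_ N x) 0).
  by rewrite cabs_real.
by apply/eqP; rewrite eq_complex /= subr0 !eqxx.
Qed.

Lemma lip_dense f (x0 : S) : cintegrable mu f -> lip_approx f.
Proof.
move=> [fr fi].
have := lip_approxD (lip_approx_real x0 fr) (lip_approxZ (Complex 0 1) (lip_approx_real x0 fi)).
congr lip_approx; apply/funext => x; case: (f x) => a b.
by apply/eqP; rewrite eq_complex /= !(mul0r, mul1r, subr0, addr0, add0r) !eqxx.
Qed.

(** Multiplying the approximants by a Lipschitz cutoff makes them vanish on a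
    ball slightly smaller than the one where [f] vanishes. *)
Lemma lip_dense_off_ball f (x0 : S) (s r : R) : 0 < s -> s < r ->
  cintegrable mu f -> (forall z, mdist x0 z < r -> f z = 0) ->
  forall e, 0 < e -> exists g, [/\ lip_bounded g, forall z, mdist x0 z < s -> g z = 0 &
    l1norm mu (fun x => f x - g x) <= e].
Proof.
move=> s0 sr cf f0 e e0; have [_ af] := lip_dense x0 cf; have [g gl fg] := af e e0.
pose c z := Num.min 1 (Num.max 0 ((mdist x0 z - s) / (r - s))).
have rs0 : 0 < r - s by rewrite subr_gt0.
have c01 z : 0 <= c z <= 1.
  by rewrite /c le_min ler01 le_max lexx ge_min lexx.
have clip z1 z2 : `|c z1 - c z2| <= (r - s)^-1 * mdist z1 z2.
  have cmono (u v : R) : u <= v -> 0 <= Num.min 1 (Num.max 0 v) - Num.min 1 (Num.max 0 u) <= v - u.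
    move=> uv; have [v0|v0] := leP 0 v; have [u0|u0] := leP 0 u;
      rewrite ?(min_r ler01);
      (try have [v1|v1] := leP 1 v); (try have [u1|u1] := leP 1 u); apply/andP; split; lra.
  wlog zz : z1 z2 / mdist x0 z2 <= mdist x0 z1.
    move=> H; have [|/ltW] := leP (mdist x0 z2) (mdist x0 z1); first exact: H.
    by move=> /H; rewrite distrC metric_sym.
  have uv : (mdist x0 z2 - s) / (r - s) <= (mdist x0 z1 - s) / (r - s).
    by rewrite ler_pM2r ?invr_gt0// lerD2r.
  have /andP[c1 c2] := cmono _ _ uv; rewrite ger0_norm// (le_trans c2)//.
  rewrite -mulrBl mulrC ler_pM2l ?invr_gt0//.
  by have := metric_triangle x0 z2 z1; rewrite (metric_sym z1 z2); lra.
pose cc z : R[i] := Complex (c z) 0.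
have gl' : lip_bounded (fun z => cc z * g z).
  apply: (@lip_boundedM _ cc (Num.max 1 (r - s)^-1)) => // [z|z1 z2].
    by rewrite cabs_real; have /andP[c0 c1] := c01 z; rewrite ger0_norm// le_max c1.
  have -> : cc z1 - cc z2 = Complex (c z1 - c z2) 0.
    by apply/eqP; rewrite eq_complex /= subr0 !eqxx.
  rewrite cabs_real (le_trans (clip _ _))// ler_wpM2r ?mdist_ge0//.
  by rewrite le_max lexx orbT.
exists (fun z => cc z * g z); split=> //.
- move=> z zs; rewrite (_ : cc z = 0) ?mul0r// /cc /c; congr Complex.
  rewrite (max_l _) ?min_r ?ler01//.
  by rewrite pmulr_lle0 ?invr_gt0// subr_le0 ltW.
- apply: le_trans fg; apply: le_l1norm; first exact: cintegrableB cf (lip_cint gl').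
    exact: cintegrable_cabs (cintegrableB cf (lip_cint gl)).
  move=> z; have fE : f z = cc z * f z.
    have [/f0 ->|rz] := ltP (mdist x0 z) r; first by rewrite mulr0.
    rewrite (_ : cc z = 1) ?mul1r// /cc /c; congr Complex; apply: min_l.
    by rewrite le_max ler_pdivlMr// mul1r lerD2r rz orbT.
  rewrite [X in cabs (X - _)]fE -mulrBr cabsM cabs_real; have /andP[c0 c1] := c01 z.
  by rewrite ger0_norm// ler_piMl ?cabs_ge0.
Qed.

End lip_closure.

(** * Passage to L1 by the weak type bound *)

Section weak_limit.
Context {d : measure_display} {R : realType} {S : borelMetricType d R}.
Variables (mu : {measure set S -> \bar R}) (m : nat).
Variable (T : ('I_m -> S -> R[i]) -> S -> R[i]).
Implicit Types f g : S -> R[i].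

Lemma dfwith_id (I : eqType) (V : I -> Type) (F : forall i, V i) i : dfwith F i (F i) = F.
Proof.
apply: functional_extensionality_dep => j.
by have [<-|ij] := eqVneq i j; rewrite ?dfwithin ?dfwithout.
Qed.

Lemma cintegrable_dfwith (F : 'I_m -> S -> R[i]) k g :
  (forall i, cintegrable mu (F i)) -> cintegrable mu g ->
  forall i, cintegrable mu (dfwith F k g i).
Proof. by move=> cF cg i; case: dfwithP => [|j _]. Qed.

Lemma prod_dfwith (N : (S -> R[i]) -> R) (F : 'I_m -> S -> R[i]) k g :
  \prod_i N (dfwith F k g i) = N g * \prod_(i | i != k) N (F i).
Proof.
rewrite (bigD1 k)//= dfwithin; congr (_ * _).
by apply: eq_bigr => i ik; rewrite dfwithout// eq_sym.
Qed.

Hypothesis hm : (0 < m)%N.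
Hypothesis linT : L1_multilinear mu T.
Variable A : R.
Hypothesis weakT : forall F, (forall i, cintegrable mu (F i)) -> forall l : R, 0 < l ->
  (l%:E * (mu [set x | (l < cabs (T F x))%R]) ^+ m
     <= A%:E * \prod_(i < m) cLnorm mu 1 (F i))%E.

Lemma weak_measure_le (F : 'I_m -> S -> R[i]) (l : R) : (forall i, cintegrable mu (F i)) ->
  0 < l -> A * \prod_i l1norm mu (F i) <= l ^+ m.+1 ->
  (mu [set x | (l < cabs (T F x))%R] <= l%:E)%E.
Proof.
move=> cF l0 Al; have := weakT cF l0.
rewrite (eq_bigr (fun i => (l1norm mu (F i))%:E)); last by move=> i _; rewrite cLnorm1E.
rewrite prodEFin -EFinM => /le_trans; move: Al; rewrite -lee_fin => Al /(_ _ Al).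
set u := mu _; have : (0 <= u)%E by exact: measure_ge0.
case: u => [r r0|_|//].
  rewrite -EFin_expe -EFinM !lee_fin exprS ler_pM2l// => rl.
  by rewrite -(ler_pXn2r hm) ?nnegrE ?(ltW l0).
have ooX n : (+oo ^+ n.+1 = +oo :> \bar R)%E.
  by elim: n => [|n IH]; rewrite expeS ?expe0 ?mule1// IH mulyy.
by rewrite -(prednK hm) ooX gt0_muley ?lte_fin.
Qed.

Definition converges_ae (u : nat -> S -> R[i]) (v : S -> R[i]) :=
  exists2 Z, mu.-negligible Z & forall x, ~ Z x -> forall e, 0 < e ->
    exists n0, forall n, (n0 <= n)%N -> cabs (u n x - v x) <= e.

(** The weak type inequality gives convergence in measure; taking the approximants
    close enough to [F k], Borel-Cantelli turns it into convergence almost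
    everywhere. *)
Lemma slot_converges_ae (F : 'I_m -> S -> R[i]) k (G : set (S -> R[i])) :
  (forall i, cintegrable mu (F i)) -> (forall g, G g -> cintegrable mu g) ->
  (forall e, 0 < e -> exists2 g, G g & l1norm mu (fun x => F k x - g x) <= e) ->
  exists g_ : nat -> S -> R[i],
    [/\ forall n, G (g_ n), forall n, l1norm mu (fun x => F k x - g_ n x) <= 2^-1 ^+ n &
        converges_ae (fun n => T (dfwith F k (g_ n))) (T F)].
Proof.
move=> cF cG dG.
pose P := \prod_(i | i != k) l1norm mu (F i).
have P0 : 0 <= P by apply: prodr_ge0 => i _; exact: l1norm_ge0.
pose A' := `|A| * P + 1.
have A'0 : 0 < A' by rewrite ltr_wpDl// mulr_ge0.
pose l n : R := 2^-1 ^+ n.+1.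
have l0 n : 0 < l n by rewrite exprn_gt0// invr_gt0.
have del0 n : 0 < Num.min (2^-1 ^+ n) (l n ^+ m.+1 / A').
  by rewrite lt_min exprn_gt0 ?invr_gt0//= divr_gt0// exprn_gt0.
have /choice[g_ g_P] : forall n, exists g, G g /\
    l1norm mu (fun x => F k x - g x) <= Num.min (2^-1 ^+ n) (l n ^+ m.+1 / A').
  by move=> n; have [g Gg gF] := dG _ (del0 n); exists g.
have Gg n : G (g_ n) by have [] := g_P n.
exists g_; split=> [//|n|].
  by have [_] := g_P n; rewrite le_min => /andP[].
pose h_ n x : R[i] := -1 * g_ n x + F k x.
have ch n : cintegrable mu (h_ n).
  apply: (@eq_cintegrable _ _ _ mu (fun x => F k x - g_ n x)).
    by move=> x; rewrite /h_ mulN1r addrC.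
  exact: cintegrableB (cF k) (cG _ (Gg n)).
have cdh n := cintegrable_dfwith k cF (ch n).
pose E n := [set x | l n < cabs (T (dfwith F k (h_ n)) x)].
have mE n : measurable (E n).
  have mT := cmeasurable_cabs (linT.1 _ (cdh n)).
  rewrite /E -[X in measurable X]setTI.
  by have := mT measurableT `]l n, +oo[%classic (measurable_itv _); rewrite preimage_itvoy.
have muE n : (mu (E n) <= (l n)%:E)%E.
  apply: weak_measure_le => //; rewrite prod_dfwith -/P.
  have -> : l1norm mu (h_ n) = l1norm mu (fun x => F k x - g_ n x).
    by apply: eq_Rintegral => x _; rewrite /h_ mulN1r addrC.
  have [_] := g_P n; rewrite le_min => /andP[_ hl].
  rewrite (@le_trans _ _ (`|A| * P * (l n ^+ m.+1 / A')))//.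
    apply: (@le_trans _ _ (`|A| * (l1norm mu (fun x => F k x - g_ n x) * P))).
      by rewrite ler_wpM2r ?mulr_ge0 ?l1norm_ge0// ler_norm.
    by rewrite -mulrA ler_wpM2l// mulrC ler_wpM2l.
  rewrite mulrCA ger_pMr ?exprn_gt0// ler_pdivrMr// mul1r.
  by rewrite lerDl.
have ZE : mu.-negligible (lim_sup_set E).
  exists (lim_sup_set E); split => //.
    by apply: bigcap_measurable => // n _; exact: bigcup_measurable.
  apply: lim_sup_set_cvg0 => //.
  apply: (@le_lt_trans _ _ (\sum_(0 <= n <oo) (0 + (1 / (2 ^ n.+1)%:R)%:E))%E).
    apply: lee_nneseries => // n _; rewrite add0e (le_trans (muE n))// lee_fin.
    by rewrite /l mul1r exprVn natrX.
  apply: (le_lt_trans (@epsilon_trick R (fun=> 0%E) 1 xpredT _ _)) => //.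
  by rewrite eseries0 ?add0e ?ltry.
have [_ /(_ F k (-1) (_ : S -> R[i]) (F k) cF _ (cF k)) lin] := linT.
have ZN n := lin (g_ n) (cG _ (Gg n)).
exists (lim_sup_set E `|` \bigcup_n ~` [set x | T (dfwith F k (h_ n)) x =
     -1 * T (dfwith F k (g_ n)) x + T (dfwith F k (F k)) x]).
  by apply: negligibleU => //; apply: negligible_bigcup => n; exact: ZN.
move=> x /not_orP[nE nN] e e0.
have [n1 En1] : exists n1, forall n, (n1 <= n)%N -> ~ E n x.
  apply: contrapT => H; apply: nE => n _; apply: contrapT => H'; apply: H.
  by exists n => j nj Ej; apply: H'; exists j.
have [n2 n2e] : exists n2 : nat, e^-1 < n2%:R.
  by exists (Num.truncn e^-1).+1; exact: truncnS_gt.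
exists (maxn n1 n2) => n; rewrite geq_max => /andP[n1n n2n].
have hE : T (dfwith F k (h_ n)) x = -1 * T (dfwith F k (g_ n)) x + T F x.
  by apply: contrapT => H; apply: nN; exists n => //= H'; apply: H; rewrite H' dfwith_id.
have := En1 _ n1n; rewrite /E /= hE mulN1r => /negP; rewrite -leNgt => hl.
rewrite -cabsN opprB addrC (le_trans hl)// /l exprVn -[e]invrK lef_pV2 ?posrE ?exprn_gt0 ?invr_gt0//.
rewrite (le_trans (ltW n2e))// (le_trans (_ : _ <= n%:R))// ?ler_nat//.
by rewrite -natrX ler_nat ltnW// ltnW// ltn_expl.
Qed.

Section closure.
Variables (N : (S -> R[i]) -> R) (c beta : R) (kap : R[i]) (B : set S).
Hypotheses (c0 : 0 <= c) (beta0 : 0 <= beta).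
Hypothesis N0 : forall f, cintegrable mu f -> 0 <= N f.
Hypothesis NL : forall f g, cintegrable mu f -> cintegrable mu g ->
  N g <= N f + c * l1norm mu (fun x => f x - g x).

(** With [kap = 0] this bounds the size of [T F] on [B], with [kap = 1] its
    oscillation. *)
Definition ae_bound (F : 'I_m -> S -> R[i]) :=
  exists2 Z, mu.-negligible Z & forall x x', (B `\` Z) x -> (B `\` Z) x' ->
    cabs (T F x - kap * T F x') <= beta * \prod_i N (F i).

Lemma ae_bound_slot (F : 'I_m -> S -> R[i]) k (G : set (S -> R[i])) :
  (forall i, cintegrable mu (F i)) -> (forall g, G g -> cintegrable mu g) ->
  (forall e, 0 < e -> exists2 g, G g & l1norm mu (fun x => F k x - g x) <= e) ->
  (forall g, G g -> ae_bound (dfwith F k g)) -> ae_bound F.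
Proof.
move=> cF cG dG bG; have [g_ [Gg gl [Z0 nZ0 HZ0]]] := slot_converges_ae cF cG dG.
have /choice[Z_ HZ_] : forall n, exists Z, mu.-negligible Z /\
  forall x x', (B `\` Z) x -> (B `\` Z) x' ->
    cabs (T (dfwith F k (g_ n)) x - kap * T (dfwith F k (g_ n)) x')
      <= beta * \prod_i N (dfwith F k (g_ n) i).
  by move=> n; have [Z nZ HZ] := bG _ (Gg n); exists Z.
exists (Z0 `|` \bigcup_n Z_ n).
  by apply: negligibleU => //; apply: negligible_bigcup => n; have [] := HZ_ n.
move=> x x' [Bx /not_orP[Zx Zx1]] [Bx' /not_orP[Zx' Zx'1]].
pose P := \prod_(i | i != k) N (F i).
have P0 : 0 <= P by apply: prodr_ge0 => i _; exact: N0.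
pose M := beta * c * P + (1 + cabs kap) + 1.
have M0 : 0 < M by rewrite ltr_wpDl// addr_ge0 ?mulr_ge0// addr_ge0 ?cabs_ge0.
apply/ler_addgt0Pl => e e0; have e'0 : 0 < e / M by rewrite divr_gt0.
have [n1 Hn1] := HZ0 x Zx _ e'0; have [n2 Hn2] := HZ0 x' Zx' _ e'0.
have [n3 n3e] : exists n3 : nat, (e / M)^-1 < n3%:R.
  by exists (Num.truncn (e / M)^-1).+1; exact: truncnS_gt.
pose n := (n1 + n2 + n3)%N.
have H1 : cabs (T F x - T (dfwith F k (g_ n)) x) <= e / M.
  by rewrite cabs_distC Hn1// /n -addnA leq_addr.
have H2 : cabs (T (dfwith F k (g_ n)) x' - T F x') <= e / M.
  by rewrite Hn2// /n addnAC leq_addl.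
have H3 : 2^-1 ^+ n <= e / M.
  rewrite exprVn -[e / M]invrK lef_pV2 ?posrE ?exprn_gt0 ?invr_gt0//.
  rewrite (le_trans (ltW n3e))// -natrX ler_nat.
  by rewrite (leq_trans _ (ltnW (ltn_expl n (ltnSn 1))))// /n leq_addl.
have [_ Hn] := HZ_ n.
have {Hn} H4 : cabs (T (dfwith F k (g_ n)) x - kap * T (dfwith F k (g_ n)) x')
      <= beta * (N (F k) * P) + beta * c * P * (e / M).
  apply: (le_trans (Hn x x' _ _)).
  - by split=> // Zn; apply: Zx1; exists n.
  - by split=> // Zn; apply: Zx'1; exists n.
  rewrite prod_dfwith -/P.
  have NF := NL (cF k) (cG _ (Gg n)).
  apply: (@le_trans _ _ (beta * ((N (F k) + c * (e / M)) * P))).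
    rewrite ler_wpM2l// ler_wpM2r// (le_trans NF)// lerD2l ler_wpM2l//.
    exact: le_trans (gl n) H3.
  by apply: eq_ler; ring.
rewrite [X in _ <= _ + _ * X](_ : _ = N (F k) * P); last by rewrite (bigD1 k).
have -> : T F x - kap * T F x' = (T F x - T (dfwith F k (g_ n)) x) +
   ((T (dfwith F k (g_ n)) x - kap * T (dfwith F k (g_ n)) x') +
   kap * (T (dfwith F k (g_ n)) x' - T F x')) by ring.
rewrite (le_trans (ler_cabsD _ _))//.
rewrite (le_trans (lerD H1 (ler_cabsD _ _)))// cabsM.
have H5 := ler_wpM2l (cabs_ge0 kap) H2.
rewrite (le_trans (lerD (lexx _) (lerD H4 H5)))//.
have Me : M * (e / M) = e by rewrite mulrCA divff ?mulr1// gt_eqF.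
rewrite -[X in _ <= X + _]Me /M.
move: (e / M) e'0 => t t0 {H1 H2 H3 H4 H5 Me n3e Hn1 Hn2}.
by rewrite -subr_ge0 [leRHS](_ : _ = t) ?ltW//; ring.
Qed.

(** The functions are replaced one slot at a time, because [T] is only linear in
    each slot separately. *)
Lemma ae_bound_closure (G L : 'I_m -> set (S -> R[i])) :
  (forall i g, G i g -> cintegrable mu g) ->
  (forall i f, L i f -> cintegrable mu f /\
    forall e, 0 < e -> exists2 g, G i g & l1norm mu (fun x => f x - g x) <= e) ->
  (forall F, (forall i, G i (F i)) -> ae_bound F) ->
  forall F, (forall i, L i (F i)) -> ae_bound F.
Proof.
move=> cG dL bG F LF.
suff H k : forall F', (forall i : 'I_m, if (i < k)%N then L i (F' i) else G i (F' i)) ->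
    ae_bound F'.
  by apply: (H m) => i; rewrite ltn_ord.
elim: k => [|k IH] F' HF'; first exact: bG.
have [km|mk] := ltnP k m; last first.
  apply: IH => i; have := HF' i; rewrite ltnS.
  by rewrite (leq_trans (ltnW (ltn_ord i)))// (leq_trans (ltn_ord i)).
pose i0 := Ordinal km.
have cF' i : cintegrable mu (F' i).
  by have := HF' i; case: ifP => _; [move/dL => []|exact: cG].
have := HF' i0; rewrite /= ltnSn => /dL[_ d0].
apply: (ae_bound_slot (k := i0) cF' (@cG i0) d0) => g Gg.
apply: IH => i; case: dfwithP => [|j /eqP ij]; first by rewrite ltnn.
have := HF' j; rewrite ltnS leq_eqVlt; case: eqP => // jk.
by case: ij; apply: val_inj.
Qed.

End closure.
End weak_limit.

(** * Averages, Hölder test functions and the extended operator *)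

Section averages.
Context {d : measure_display} {R : realType} {S : borelMetricType d R}.
Variables (mu : {measure set S -> \bar R}) (Cmu : R).
Hypothesis hmu : doubling mu Cmu.
Implicit Types f g : S -> R[i].

Lemma integral_restr0 f (E : set S) : measurable E -> cintegrable mu f ->
  (\int[mu]_(x in E) (cabs (f x))%:E)%E = (l1norm mu (restr0 f E))%:E.
Proof.
move=> mE cf; rewrite -l1normE; last exact: cintegrable_restr0.
rewrite [LHS]integral_mkcond; apply: eq_integral => x _.
by rewrite /restr0 /patch; case: ifP => //; rewrite cabs0.
Qed.

Lemma Rintegral_indic_restr0 f (E : set S) :
  \int[mu]_z (cabs (f z) * \1_E z) = l1norm mu (restr0 f E).
Proof.
apply: eq_Rintegral => x _; rewrite indicE /restr0 /patch.
by case: (x \in E); rewrite ?mulr1// mulr0 cabs0.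
Qed.

Lemma l1norm_restr0_le f (E : set S) : measurable E -> cintegrable mu f ->
  l1norm mu (restr0 f E) <= l1norm mu f.
Proof.
move=> mE cf; apply: le_l1norm; first exact: cintegrable_restr0.
  exact: cintegrable_cabs.
by move=> x; exact: restr0_cabs_le.
Qed.

Lemma l1norm_restr0C f (E E' : set S) : measurable E -> measurable E' -> cintegrable mu f ->
  l1norm mu (restr0 (restr0 f E) E') <= l1norm mu (restr0 f E').
Proof.
move=> mE mE' cf; apply: le_l1norm; first by do 2 apply: cintegrable_restr0 => //.
  exact: cintegrable_cabs (cintegrable_restr0 mE' cf).
move=> x; rewrite {1 3}/restr0 /patch; case: ifP => // _; exact: restr0_cabs_le.
Qed.

Lemma avgE f (E : set S) : measurable E -> cintegrable mu f ->
  avg mu f E = ((fine (mu E))^-1 * l1norm mu (restr0 f E))%:E.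
Proof. by move=> mE cf; rewrite /avg integral_restr0// EFinM. Qed.

Lemma balls_star_measurable (B : set S) : balls_star mu B -> measurable B.
Proof. by case=> [[x [r _ ->]]|[_ ->]//]; exact: measurable_mball. Qed.

Lemma balls_star_lty (B : set S) : balls_star mu B -> (mu B < +oo)%E.
Proof. by case=> [[x [r _ ->]]|[+ ->]//]; exact: doubling_ball_lty hmu _ _. Qed.

Variables (x0 : S) (r0 : R).
Hypothesis r00 : 0 < r0.
Let B0 : set S := ball x0 r0.
Let v := vol mu x0 r0.
Let v0 : 0 < v. Proof. exact: vol_gt0 hmu _ _ r00. Qed.

Definition sup_avgr f : R := fine (sup_avg mu (balls_star mu) f B0).

Let fine_ge (B : set S) : balls_star mu B -> B0 `<=` B -> v <= fine (mu B).
Proof.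
move=> fB B0B; rewrite fine_le//.
- by rewrite ge0_fin_numE// (doubling_ball_lty hmu).
- by rewrite ge0_fin_numE// balls_star_lty.
- by apply: le_measure; rewrite ?inE//; [exact: measurable_mball|exact: balls_star_measurable].
Qed.

Let inv_ge0 (B : set S) : 0 <= (fine (mu B))^-1.
Proof. by rewrite invr_ge0 fine_ge0. Qed.

Let avg_le f (B : set S) : cintegrable mu f -> balls_star mu B -> B0 `<=` B ->
  (fine (mu B))^-1 * l1norm mu (restr0 f B) <= v^-1 * l1norm mu f.
Proof.
move=> cf fB B0B; have vB := fine_ge fB B0B.
rewrite ler_pM ?l1norm_ge0//.
- by rewrite lef_pV2 ?posrE// (lt_le_trans v0).
- by apply: l1norm_restr0_le => //; exact: balls_star_measurable.
Qed.

Lemma sup_avgE f : cintegrable mu f ->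
  sup_avg mu (balls_star mu) f B0 = (sup_avgr f)%:E.
Proof.
move=> cf; rewrite /sup_avgr fineK//.
have fB0 : balls_star mu B0 by left; exists x0, r0.
rewrite ge0_fin_numE.
  apply: (@le_lt_trans _ _ (v^-1 * l1norm mu f)%:E); last exact: ltry.
  apply: ge_ereal_sup => _ [B [fB B0B] <-].
  have mB := balls_star_measurable fB.
  by rewrite avgE// lee_fin; exact: avg_le.
apply: le_ereal_sup_tmp; exists (avg mu f B0); first by exists B0 => //; split=> //; exact: subset_refl.
have mB0 : measurable B0 by exact: measurable_mball.
rewrite avgE// lee_fin.
by rewrite mulr_ge0 ?inv_ge0 ?l1norm_ge0.
Qed.

Lemma avg_le_sup f (B : set S) : cintegrable mu f -> balls_star mu B -> B0 `<=` B ->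
  (fine (mu B))^-1 * l1norm mu (restr0 f B) <= sup_avgr f.
Proof.
move=> cf fB B0B; rewrite -lee_fin -sup_avgE// -avgE//; last exact: balls_star_measurable.
by apply: le_ereal_sup_tmp; exists (avg mu f B) => //; exists B.
Qed.

Lemma sup_avgr_le f c : cintegrable mu f ->
  (forall B, balls_star mu B -> B0 `<=` B -> (fine (mu B))^-1 * l1norm mu (restr0 f B) <= c) ->
  sup_avgr f <= c.
Proof.
move=> cf H; rewrite -lee_fin -sup_avgE//; apply: ge_ereal_sup => _ [B [fB B0B] <-].
have mB := balls_star_measurable fB.
by rewrite avgE// lee_fin; exact: H.
Qed.

Lemma sup_avgr_ge0 f : cintegrable mu f -> 0 <= sup_avgr f.
Proof.
move=> cf; have fB0 : balls_star mu B0 by left; exists x0, r0.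
by rewrite (le_trans _ (avg_le_sup cf fB0 (subset_refl _)))// mulr_ge0 ?inv_ge0 ?l1norm_ge0.
Qed.

Lemma sup_avgr_lip f g : cintegrable mu f -> cintegrable mu g ->
  sup_avgr g <= sup_avgr f + v^-1 * l1norm mu (fun x => f x - g x).
Proof.
move=> cf cg; apply: sup_avgr_le => // B fB B0B.
have mB := balls_star_measurable fB.
have cfg := cintegrableB cf cg.
rewrite (@le_trans _ _ ((fine (mu B))^-1 * (l1norm mu (restr0 f B) +
    l1norm mu (restr0 (fun x => f x - g x) B))))//.
  rewrite ler_wpM2l//.
  have := l1norm_sub (cintegrable_restr0 mB cg) (cintegrable_restr0 mB cf).
  rewrite l1norm_distC => /le_trans; apply; rewrite lerD2l; apply: eq_ler.
  apply: eq_Rintegral => x _; rewrite /restr0 /patch; case: ifP => //.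
  by rewrite subrr.
by rewrite mulrDr lerD ?avg_le_sup// avg_le.
Qed.

Lemma sup_avgr_restr f (E : set S) : measurable E -> cintegrable mu f ->
  sup_avgr (restr0 f E) <= sup_avgr f.
Proof.
move=> mE cf; apply: sup_avgr_le; first exact: cintegrable_restr0.
move=> B fB B0B; apply: le_trans (avg_le_sup cf fB B0B); rewrite ler_wpM2l//.
by apply: l1norm_restr0C => //; exact: balls_star_measurable.
Qed.

End averages.

Section holder.
Context {d : measure_display} {R : realType} {S : borelMetricType d R}.
Variable mu : {measure set S -> \bar R}.

Lemma lip_bounded_Cb (alpha : R) (h : S -> R[i]) : 0 < alpha -> alpha <= 1 ->
  lip_bounded h -> Cb mu alpha h.
Proof.
move=> al0 al1 [x0 [A hA]]; have A0 := lip_bounded_cst_ge0 hA; have [h1 h2 h3] := hA.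
split.
  exists x0, A => x /= hx; apply: contrapT => /h3 hx0.
  by rewrite hx0 eqxx in hx.
have Hs : (ereal_sup [set (cabs (h p.1 - h p.2) / mdist p.1 p.2 `^ alpha)%:E
    | p in [set: S * S]] <= (A + A)%:E)%E.
  apply: ge_ereal_sup => _ [[x y] _ <-] /=; rewrite lee_fin.
  have [->|xy] := eqVneq x y; first by rewrite subrr cabs0 mul0r addr_ge0.
  have d0 : 0 < mdist x y by rewrite mdist_gt0.
  rewrite ler_pdivrMr ?powR_gt0//; have [d1|d1] := leP (mdist x y) 1.
    rewrite (le_trans (h2 x y))// (@le_trans _ _ (A * mdist x y `^ alpha))//.
      rewrite ler_wpM2l// -[leLHS]powRr1 ?(ltW d0)//; apply: ger_powR => //.
      by rewrite d0.
    by rewrite ler_wpM2r ?powR_ge0// lerDl.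
  rewrite (le_trans (ler_cabsB _ _))// (le_trans (lerD (h1 x) (h1 y)))//.
  rewrite ler_peMr ?addr_ge0// -(powRr0 (mdist x y)); apply: ler_powR; exact: ltW.
have HL : (cLnorm mu +oo h <= A%:E)%E.
  rewrite /cLnorm unlock; case: ifP => _; last by rewrite lee_fin.
  by apply/ess_supP; apply: aeW => x /=; rewrite lee_fin ger0_norm ?cabs_ge0.
by apply: le_lt_trans (leeD HL Hs) _; rewrite -EFinD ltry.
Qed.

End holder.

Section far_bounds.
Context {d : measure_display} {R : realType} {S : borelMetricType d R}.
Variables (mu : {measure set S -> \bar R}) (Cmu : R).
Hypothesis hmu : doubling mu Cmu.
Variables (m : nat) (w : R -> R) (CK : R) (K : S -> ('I_m -> S) -> R[i]).
Hypotheses (modw : modulus_of_continuity w) (dini : (dini_norm w < +oo)%E).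
Hypotheses (CK0 : 0 < CK) (hK : CZ_kernel mu w CK K).
Hypothesis hm : (0 < m)%N.
Variable T : ('I_m -> S -> R[i]) -> S -> R[i].
Hypothesis linT : L1_multilinear mu T.
Variable A : R.
Hypothesis weakT : forall F, (forall i, cintegrable mu (F i)) -> forall l : R, 0 < l ->
  (l%:E * (mu [set x | (l < cabs (T F x))%R]) ^+ m
     <= A%:E * \prod_(i < m) cLnorm mu 1 (F i))%E.
Hypothesis repT : forall h, (forall i, lip_bounded (h i)) ->
  {ae mu, forall x, ~ (forall i, csupp (h i) x) -> T h x = iter_cintegral mu (kernel_integrand K h x)}.

Let muballoo := doubling_ball_lty hmu.

(** A function vanishing on [ball x0 (2 * s)] has no point of [ball x0 s] in its
    closed support, so the kernel represents the operator at almost all these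
    points. *)
Lemma rep_near h (i0 : 'I_m) (x0 : S) s : (forall i, lip_bounded (h i)) -> 0 < s ->
  (forall z, mdist x0 z < 2 * s -> h i0 z = 0) ->
  exists2 Z, mu.-negligible Z & forall x, ~ Z x -> mdist x0 x < s ->
    T h x = iter_cintegral mu (kernel_integrand K h x).
Proof.
move=> hl s0 hs; exists (~` [set x | ~ (forall i, csupp (h i) x) ->
    T h x = iter_cintegral mu (kernel_integrand K h x)]); first exact: repT hl.
move=> x /= /contrapT H xs; apply: H => /(_ i0) /(_ (ball x s)).
case=> [|z [/= hz /ballP xz]]; first exact: nbhsx_ballx.
by move/eqP: hz; apply; apply: hs; have := metric_triangle x0 x z; lra.
Qed.

Section centre.
Variables (x0 : S) (r0 : R).
Hypothesis r00 : 0 < r0.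

Let Cmu1 : 1 <= Cmu. Proof. exact: doubling_cst_ge1 hmu x0. Qed.

(** The constants of the two estimates for an operator applied to functions of
    which one vanishes on the double of [ball x0 r0]: [size_cst] is, up to
    doubling, [CK] over the [m]-th power of the volume of that ball. *)
Definition size_cst := 2 ^+ m * (CK * (Cmu ^+ 2 / vol mu x0 r0) ^+ m).

Definition osc_cst := 2 ^+ m.+2 * CK * Cmu ^+ m * fine (dini_norm w).

Lemma lip_size h (i0 : 'I_m) s : (forall i, lip_bounded (h i)) -> r0 / 2 <= s ->
  (forall z, mdist x0 z < 2 * s -> h i0 z = 0) ->
  ae_bound mu T (l1norm mu) size_cst 0 (ball x0 s) h.
Proof.
move=> hl rs hs; have s0 : 0 < s by apply: lt_le_trans rs; rewrite divr_gt0.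
have [Z nZ HZ] := rep_near hl s0 hs; exists Z => // x x' [/ballP xs Zx] _.
rewrite mul0r subr0 HZ//.
have [B B1 hB] := lip_family x0 hl.
have hxs z : mdist x z < s -> h i0 z = 0.
  by move=> xz; apply: hs; have := metric_triangle x0 x z; lra.
rewrite (le_trans (kernel_integrand_iter_le hmu modw dini CK0 hK B1 hB s0 hxs))//.
rewrite /size_cst -[leRHS]mulrA ler_pM2l ?exprn_gt0// ler_wpM2r ?prodr_ge0//.
  by move=> i _; exact: l1norm_ge0.
have v0 := vol_gt0 hmu x0 r00; have vx0 := vol_gt0 hmu x s0.
rewrite ler_pM2l// -exprVn lerXn2r ?nnegrE ?invr_ge0 ?divr_ge0 ?exprn_ge0 ?vol_ge0 ?(le_trans _ Cmu1)//.
rewrite ler_pdivlMr// mulrC ler_pdivrMr//.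
have r20 : 0 < r0 / 2 by rewrite divr_gt0.
have h1 : vol mu x0 r0 <= Cmu * vol mu x0 (r0 / 2).
  by have := vol_double hmu x0 r20; rewrite (_ : 2 * (r0 / 2) = r0)//; field.
have h2 : vol mu x0 (r0 / 2) <= vol mu x0 s by apply: (le_vol hmu); exact: subset_ballr.
have h3 : vol mu x0 s <= vol mu x (2 * s).
  apply: (le_vol hmu) => z /ballP zs; apply/ballP.
  by have := metric_triangle x x0 z; rewrite (metric_sym x x0); lra.
have h4 := vol_double hmu x s0.
rewrite (le_trans h1)// expr2 -mulrA ler_wpM2l ?(le_trans _ Cmu1)//.
by rewrite (le_trans h2)// (le_trans h3).
Qed.

(** The number [iter_cintegral mu (kernel_integrand K h x0)] plays the part of a common
    approximate value on the ball. It need not be the value of [T h] at [x0], which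
    may lie in the exceptional null set. *)
Lemma lip_osc h (i0 : 'I_m) s : (forall i, lip_bounded (h i)) -> r0 / 2 <= s ->
  (forall z, mdist x0 z < 2 * s -> h i0 z = 0) ->
  ae_bound mu T (sup_avgr mu x0 r0) osc_cst 1 (ball x0 s) h.
Proof.
move=> hl rs hs; have s0 : 0 < s by apply: lt_le_trans rs; rewrite divr_gt0.
have [Z nZ HZ] := rep_near hl s0 hs; exists Z => // x x' [/ballP xs Zx] [/ballP xs' Zx'].
have [B B1 hB] := lip_family x0 hl.
rewrite mul1r !HZ//.
have H y : mdist x0 y < s ->
    cabs (iter_cintegral mu (kernel_integrand K h y) - iter_cintegral mu (kernel_integrand K h x0)) <=
    2 ^+ m.+1 * CK * Cmu ^+ m * fine (dini_norm w) * \prod_i sup_avgr mu x0 r0 (h i).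
  move=> ys; apply: (kernel_integrand_osc hmu modw dini CK0 hK B1 hB s0 ys hs) => k i.
  rewrite Rintegral_indic_restr0; set r := 2 ^+ k.+2 * s.
  have sr : r0 <= r.
    rewrite /r (@le_trans _ _ (2 * s))//; first lra.
    by rewrite ler_wpM2r ?(ltW s0)// exprS ler_peMr// exprn_ege1// ler1n.
  have r0' : 0 < r by exact: lt_le_trans sr.
  have ch : cintegrable mu (h i) by exact: lip_bounded_cintegrable.
  have := @avg_le_sup _ _ _ mu _ hmu x0 r0 r00 (h i) (ball x0 r) ch.
  rewrite -[fine _]/(vol mu x0 r) mulrC ler_pdivrMr ?(vol_gt0 hmu)//; apply.
    by left; exists x0, r.
  exact: subset_ballr.
rewrite (le_trans (ler_cabs_dist _ _ (iter_cintegral mu (kernel_integrand K h x0))))//.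
rewrite [X in _ + X]cabs_distC (le_trans (lerD (H _ xs) (H _ xs')))//.
by rewrite /osc_cst [2 ^+ m.+2]exprS -!mulrA mulrDl mul1r.
Qed.

Section closure.
Variables (N : (S -> R[i]) -> R) (c beta : R) (kap : R[i]) (i0 : 'I_m).
Hypotheses (c0 : 0 <= c) (beta0 : 0 <= beta).
Hypothesis N0 : forall f, cintegrable mu f -> 0 <= N f.
Hypothesis NL : forall f g, cintegrable mu f -> cintegrable mu g ->
  N g <= N f + c * l1norm mu (fun x => f x - g x).
Hypothesis lipB : forall h s, (forall i, lip_bounded (h i)) -> r0 / 2 <= s ->
  (forall z, mdist x0 z < 2 * s -> h i0 z = 0) -> ae_bound mu T N beta kap (ball x0 s) h.

(** Room for a cutoff is made by shrinking the ball; countably many radii [s]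
    exhaust it. *)
Lemma far_closure F : (forall i, cintegrable mu (F i)) ->
  (forall z, mdist x0 z < 2 * r0 -> F i0 z = 0) -> ae_bound mu T N beta kap (ball x0 r0) F.
Proof.
move=> cF F0; pose s n : R := r0 * (1 - n.+2%:R^-1).
have n2 n : 0 < n.+2%:R :> R by rewrite ltr0n.
have ninv n : n.+2%:R^-1 <= 2^-1 :> R.
  by rewrite lef_pV2 ?posrE// ler_nat.
have s2 n : r0 / 2 <= s n by rewrite /s ler_pM2l//; have := ninv n; move: (n.+2%:R^-1) => t; lra.
have sr n : s n < r0 by rewrite /s gtr_pMr// ltrBlDr ltrDl invr_gt0.
have s0 n : 0 < s n by apply: lt_le_trans (s2 n); rewrite divr_gt0.
have bF n : ae_bound mu T N beta kap (ball x0 (s n)) F.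
  apply: (ae_bound_closure hm linT weakT c0 beta0 N0 NL
    (G := fun i => [set g | lip_bounded g /\
       (i = i0 -> forall z, mdist x0 z < 2 * s n -> g z = 0)])
    (L := fun i => [set f | cintegrable mu f /\
       (i = i0 -> forall z, mdist x0 z < 2 * r0 -> f z = 0)])) => [i g [gl _]|i f [cf f0]|h hG|i].
  - exact: lip_bounded_cintegrable.
  - split=> // e e0; have [ii0|ii0] := eqVneq i i0; last first.
      have [_ /(_ e e0)[g gl fg]] := lip_dense muballoo x0 cf.
      by exists g => //; split=> // /eqP; rewrite (negbTE ii0).
    have s2n : 0 < 2 * s n by rewrite mulr_gt0.
    have sr2 : 2 * s n < 2 * r0 by rewrite ltr_pM2l.
    have [g [gl g0 fg]] := lip_dense_off_ball muballoo s2n sr2 cf (f0 ii0) e0.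
    by exists g.
  - apply: lipB => // [i|]; first by have [] := hG i.
    by have [_ /(_ erefl)] := hG i0.
  - by split=> // ->.
have /choice[Z HZ] : forall n, exists Z, mu.-negligible Z /\
   forall x x', (ball x0 (s n) `\` Z) x -> (ball x0 (s n) `\` Z) x' ->
    cabs (T F x - kap * T F x') <= beta * \prod_i N (F i).
  by move=> n; have [Z nZ H] := bF n; exists Z.
exists (\bigcup_n Z n); first by apply: negligible_bigcup => n; have [] := HZ n.
move=> x x' [/ballP xr Zx] [/ballP xr' Zx'].
pose t := Num.max (mdist x0 x) (mdist x0 x').
have tr : t < r0 by rewrite gt_max xr.
have [n Hn] : exists n, t < s n.
  have e0 : 0 < 1 - t / r0 by rewrite subr_gt0 ltr_pdivrMr// mul1r.
  exists (Num.truncn (1 - t / r0)^-1).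
  rewrite /s mulrC -ltr_pdivrMr// ltrBrDl -ltrBrDr -[ltRHS]invrK ltf_pV2 ?posrE ?invr_gt0//.
  by rewrite (lt_trans (truncnS_gt _))// ltr_nat.
have [_ H] := HZ n; apply: H; split.
- by apply/ballP; apply: le_lt_trans Hn; rewrite le_max lexx.
- by move=> Znx; apply: Zx; exists n.
- by apply/ballP; apply: le_lt_trans Hn; rewrite le_max lexx orbT.
- by move=> Znx; apply: Zx'; exists n.
Qed.

End closure.

Lemma far_size i0 F : (forall i, cintegrable mu (F i)) ->
  (forall z, mdist x0 z < 2 * r0 -> F i0 z = 0) ->
  ae_bound mu T (l1norm mu) size_cst 0 (ball x0 r0) F.
Proof.
apply: (@far_closure _ 1) => //.
- have C0 : 0 <= Cmu by exact: le_trans Cmu1.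
  by rewrite !(mulr_ge0, exprn_ge0, invr_ge0, vol_ge0)// ltW.
- by move=> f _; exact: l1norm_ge0.
- by move=> f g cf cg; rewrite mul1r l1norm_distC; exact: l1norm_sub.
- by move=> h s; exact: lip_size.
Qed.

Lemma far_osc i0 F : (forall i, cintegrable mu (F i)) ->
  (forall z, mdist x0 z < 2 * r0 -> F i0 z = 0) ->
  ae_bound mu T (sup_avgr mu x0 r0) osc_cst 1 (ball x0 r0) F.
Proof.
apply: (@far_closure _ (vol mu x0 r0)^-1).
- by rewrite invr_ge0 vol_ge0.
- have C0 : 0 <= Cmu by exact: le_trans Cmu1.
  have D0 := dini_ge0 modw.
  rewrite /osc_cst; apply: mulr_ge0 => //; apply: mulr_ge0; last exact: exprn_ge0.
  by apply: mulr_ge0; [exact: exprn_ge0|exact: ltW].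
- by move=> f; exact: sup_avgr_ge0 hmu _ _ r00 _.
- by move=> f g; exact: sup_avgr_lip hmu _ _ r00 _ _.
- by move=> h s; exact: lip_osc.
Qed.

End centre.
End far_bounds.

(** * Telescoping over the slots *)

Section telescope.
Context {d : measure_display} {R : realType} {S : borelMetricType d R}.
Variables (mu : {measure set S -> \bar R}) (m : nat).
Variable T : ('I_m -> S -> R[i]) -> S -> R[i].
Hypothesis linT : L1_multilinear mu T.
Variables (F : 'I_m -> S -> R[i]) (E : set S).
Hypotheses (mE : measurable E) (cF : forall i, cintegrable mu (F i)).

Definition cut_slots (k : nat) (i : 'I_m) : S -> R[i] :=
  if (i < k)%N then restr0 (F i) E else F i.

(** Exactly one slot, the [k]-th, is restricted to the complement of [E]: every
    term of the telescoping sum has one function vanishing on [E]. *)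
Definition far_slot (k : 'I_m) : 'I_m -> S -> R[i] :=
  dfwith (cut_slots k) k (restr0 (F k) (~` E)).

Lemma cintegrable_cut_slots k i : cintegrable mu (cut_slots k i).
Proof. by rewrite /cut_slots; case: ifP => _ //; exact: cintegrable_restr0. Qed.

Lemma cintegrable_far_slot k i : cintegrable mu (far_slot k i).
Proof.
apply: cintegrable_dfwith => [j|]; first exact: cintegrable_cut_slots.
by apply: cintegrable_restr0 => //; exact: measurableC.
Qed.

Lemma telescope_slots : exists2 Z, mu.-negligible Z & forall x, ~ Z x ->
  T F x - T (fun i => restr0 (F i) E) x = \sum_(k < m) T (far_slot k) x.
Proof.
have [_ lin] := linT.
pose P (k : 'I_m) x := T (cut_slots k) x = 1 * T (far_slot k) x + T (cut_slots k.+1) x.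
have aeP k : {ae mu, forall x, P k x}.
  have mCE : measurable (~` E) by exact: measurableC.
  have := lin (cut_slots k) k 1 _ _ (cintegrable_cut_slots k)
    (cintegrable_restr0 mCE (cF k)) (cintegrable_restr0 mE (cF k)).
  apply: filterS => x; rewrite /P /=.
  rewrite (_ : dfwith _ _ (fun y => _) = cut_slots k); last first.
    apply/funext => j; case: dfwithP => // {j}; rewrite /cut_slots ltnn.
    apply/funext => y; rewrite mul1r; have [Ey|Ey] := pselect (E y).
      by rewrite [X in X + _]restr0_out ?add0r ?restr0_in.
    by rewrite restr0_in// restr0_out// addr0.
  move=> ->; congr (_ + T _ x); apply/funext => j; case: dfwithP => [|{}j kj].
    by rewrite /cut_slots ltnSn.
  rewrite /cut_slots ltnS [in RHS]leq_eqVlt; case: eqP => //= jk.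
  by case/eqP: kj; apply: val_inj; rewrite /= jk.
(* Countable unions of null sets are indexed by [nat]; slots beyond [m] are empty. *)
exists (\bigcup_(k : nat) (if insub k is Some k' then ~` [set x | P k' x] else set0)).
  apply: negligible_bigcup => k; case: insubP => [k' _ _|_]; first exact: aeP.
  exact: negligible_set0.
move=> x nZ; have Px k : P k x.
  apply: contrapT => nP; apply: nZ; exists (val k) => //.
  by rewrite valK; exact: nP.
have -> : T F x = T (cut_slots 0) x by [].
have -> : (fun i => restr0 (F i) E) = cut_slots m.
  by apply/funext => i; rewrite /cut_slots ltn_ord.
rewrite -opprB -(telescope_sumr (fun k => T (cut_slots k) x) (leq0n m)) big_mkord -sumrN.
by apply: eq_bigr => k _; rewrite (Px k) mul1r opprB addrK.
Qed.

Variables (N : (S -> R[i]) -> R) (beta : R) (kap : R[i]) (B : set S).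
Hypothesis beta0 : 0 <= beta.
Hypothesis N0 : forall f, cintegrable mu f -> 0 <= N f.
Hypothesis NE : forall f E', measurable E' -> cintegrable mu f -> N (restr0 f E') <= N f.
Hypothesis farB : forall k, ae_bound mu T N beta kap B (far_slot k).

Lemma telescope_bound : exists2 Z, mu.-negligible Z &
  forall x x', (B `\` Z) x -> (B `\` Z) x' ->
    cabs ((T F x - T (fun i => restr0 (F i) E) x)
      - kap * (T F x' - T (fun i => restr0 (F i) E) x'))
    <= m%:R * beta * \prod_i N (F i).
Proof.
have [Z0 nZ0 HZ0] := telescope_slots.
have /choice[Z HZ] : forall k, exists Z, mu.-negligible Z /\
   forall x x', (B `\` Z) x -> (B `\` Z) x' ->
    cabs (T (far_slot k) x - kap * T (far_slot k) x') <= beta * \prod_i N (far_slot k i).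
  by move=> k; have [Z nZ H] := farB k; exists Z.
exists (Z0 `|` \bigcup_(k : nat) (if insub k is Some k' then Z k' else set0)).
  apply: negligibleU => //; apply: negligible_bigcup => k.
  by case: insubP => [k' _ _|_]; [have [] := HZ k'|exact: negligible_set0].
move=> x x' [Bx /not_orP[Z0x Zx]] [Bx' /not_orP[Z0x' Zx']].
rewrite !HZ0// mulr_sumr -sumrB (le_trans (ler_cabs_sum _ _ _))//.
rewrite -mulrA mulr_natl -[X in _ *+ X](card_ord m) -sumr_const; apply: ler_sum => k _.
have [_ H] := HZ k; apply: (le_trans (H x x' _ _)).
- by split=> // Zkx; apply: Zx; exists (val k) => //; rewrite valK.
- by split=> // Zkx; apply: Zx'; exists (val k) => //; rewrite valK.
rewrite ler_wpM2l//; apply: ler_prod => i _; apply/andP; split.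
  by apply: N0; exact: cintegrable_far_slot.
rewrite /far_slot; case: dfwithP => [|j _]; first by apply: NE => //; exact: measurableC.
by rewrite /cut_slots; case: ifP => _ //; exact: NE.
Qed.

End telescope.

(** * The theorem *)

Section star.
Context {d : measure_display} {R : realType} {S : borelMetricType d R}.
Variables (mu : {measure set S -> \bar R}) (Cmu : R).
Hypothesis hmu : doubling mu Cmu.

(** A doubling constant is at least 1 as soon as the space has a point; enlarging it
    makes this available before a point is given. *)
Lemma doubling_max1 : doubling mu (Num.max 1 Cmu).
Proof.
move=> x r r0; have [h1 h2 _] := hmu x r0; split => //.
  by rewrite (le_trans h2)// (volE hmu) -!EFinM lee_fin ler_wpM2r ?vol_ge0// le_max lexx orbT.
by rewrite (volE hmu) -EFinM ltry.
Qed.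

Variables (star : set S -> set S) (C0 : R).
Hypothesis hstar : ball_basis mu (balls_star mu) star C0.

Lemma ball_basis_sub_star (B : set S) : balls_star mu B -> B `<=` star B.
Proof.
move=> fB; have [/(_ _ fB)[mB B0 Boo] _ _ [_ _ + _]] := hstar; apply => //.
  rewrite setIid; apply/set0P/eqP => B0'.
  by move: B0; rewrite B0' measure0 ltxx.
have Bfin : mu B \is a fin_num by rewrite ge0_fin_numE.
by rewrite -(fineK Bfin) -EFinM lee_fin ler_peMl ?fine_ge0// ler1n.
Qed.

(** Doubling the radius need not enlarge the ball as a set. The first dyadic dilate
    that does has measure comparable to that of [ball x0 r0], because the dilate
    before it is still contained in [ball x0 r0]. *)
Lemma first_larger_ball (x0 : S) (r0 : R) : 0 < r0 -> ~ ([set: S] `<=` ball x0 r0) ->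
  exists r, [/\ 0 < r, ball x0 r0 `<` ball x0 r & vol mu x0 r <= Cmu * vol mu x0 r0].
Proof.
move=> r00 nT; pose P k := `[< ~ (ball x0 (2 ^+ k * r0) `<=` ball x0 r0) >].
have pr k : 0 < 2 ^+ k * r0 by rewrite mulr_gt0// exprn_gt0.
have exP : exists k, P k.
  move/existsNP : nT => [y /not_implyP[_ ny]].
  exists (Num.truncn (mdist x0 y / r0)).+1; apply/asboolP => H; apply: ny; apply: H.
  apply/ballP; rewrite -ltr_pdivrMr//; apply: (lt_trans (truncnS_gt _)).
  by rewrite -natrX ltr_nat ltn_expl.
case: (ex_minnP exP) => -[|j] /asboolP Pj jmin.
  by case: Pj; rewrite expr0 mul1r.
exists (2 ^+ j.+1 * r0); split=> //.
  split=> //; apply: subset_ballr; rewrite ler_peMl ?(ltW r00)//.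
  by rewrite exprn_ege1// ler1n.
have jsub : ball x0 (2 ^+ j * r0) `<=` ball x0 r0.
  by apply: contrapT => H; have := jmin j (asboolT H); rewrite ltnn.
rewrite exprS -mulrA (le_trans (vol_double hmu _ (pr j)))//.
by rewrite ler_wpM2l ?(le_vol hmu)// (le_trans _ (doubling_cst_ge1 hmu x0)).
Qed.

End star.

Theorem theorem2p5 (d : measure_display) (R : realType) (S : borelMetricType d R)
    (mu : {measure set S -> \bar R}) (Cmu : R)
    (hmu : doubling mu Cmu) (hdens : density_condition mu balls)
    (m : nat) (hm : (0 < m)%N) (C0 : R) :
  exists2 C : R, 0 < C &
  forall CK : R, 0 < CK ->
  exists2 C' : R, 0 < C' &
  forall (star : set S -> set S),
    ball_basis mu (balls_star mu) star C0 -> concentric_star star ->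
  forall (alpha : R) (w : R -> R)
    (T : ('I_m -> S -> R[i]) -> (S -> R[i]) -> R[i])
    (Text : ('I_m -> S -> R[i]) -> S -> R[i]),
    0 < alpha -> alpha <= 1 ->
    modulus_of_continuity w -> (exists2 t, 0 <= t & w t != 0) ->
    (dini_norm w < +oo)%E ->
    CZ_operator mu alpha w CK T -> L1_extension mu alpha T Text ->
  exists C1 C2 : R,
    [/\ bounded_oscillation mu (balls_star mu) star C1 C2 Text,
        C1 <= C * CK & (C2%:E <= C'%:E * dini_norm w)%E].
Proof.
have [Kc Kc1 hKc] : exists2 Kc, 1 <= Kc & doubling mu Kc.
  by exists (Num.max 1 Cmu); [rewrite le_max lexx|exact: doubling_max1].
have Kc0 : 0 < Kc by exact: lt_le_trans Kc1.
(* The bound [1 <= C0] comes with the ball-basis, after [C] has been chosen. *)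
pose C0' := Num.max 1 C0.
have C0'1 : 1 <= C0' by rewrite le_max lexx.
have C0'0 : 0 < C0' by exact: lt_le_trans C0'1.
have m0 : 0 < m%:R :> R by rewrite ltr0n.
exists (m%:R * 2 ^+ m * (Kc ^+ 3 * C0') ^+ m).
  by rewrite !mulr_gt0// exprn_gt0// mulr_gt0// exprn_gt0.
move=> CK CK0; exists (m%:R * (2 ^+ m.+2 * CK * Kc ^+ m)).
  by apply: mulr_gt0 => //; apply: mulr_gt0; rewrite ?exprn_gt0// mulr_gt0// exprn_gt0.
move=> star hstar hconc alpha w T Text al0 al1 modw wn0 dini.
move=> [_ _ [K hK rep] _] [linT repr [A weakT]].
have repT h : (forall i, lip_bounded (h i)) ->
    {ae mu, forall x, ~ (forall i, csupp (h i) x) -> Text h x = iter_cintegral mu (kernel_integrand K h x)}.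
  move=> hl; have hCb i : Cb mu alpha (h i) by exact: lip_bounded_Cb.
  exact: rep hCb (repr _ hCb).
have D0 := dini_gt0 modw dini wn0; set D := fine (dini_norm w) in D0.
have [B1 _ _ [C01 st1 _ st3]] := hstar.
set C1 := m%:R * 2 ^+ m * _ * CK; set C2 := m%:R * (2 ^+ m.+2 * CK * Kc ^+ m) * D.
have cst0 : 0 < m%:R * (2 ^+ m.+2 * CK * Kc ^+ m).
  by apply: mulr_gt0 => //; apply: mulr_gt0; rewrite ?exprn_gt0// mulr_gt0// exprn_gt0.
have C20 : 0 < C2 by rewrite mulr_gt0.
exists C1, C2; split=> //; last by rewrite dini_normE.
split=> //.
- by rewrite !mulr_gt0// exprn_gt0// mulr_gt0// exprn_gt0.
- move=> B0 fB0 [_ nT].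
  have B0s := ball_basis_sub_star hstar fB0.
  have nT0 : ~ ([set: S] `<=` B0) by move=> H; apply: nT; apply: subset_trans B0s.
  have bB0 : balls B0 by case: fB0 => // -[_ E]; case: nT0; rewrite E.
  have [x0 [r0 [r00 B0E [[R0 rR sE]|sT]]]] := hconc _ bB0; last by case: nT; rewrite sT.
  rewrite B0E in nT0.
  have [r [rp Br vr]] := first_larger_ball hKc r00 nT0.
  have fB : balls_star mu (ball x0 r) by left; exists x0, r.
  exists (ball x0 r); split=> //; first by rewrite B0E.
  have [fE mE0] := st1 _ fB; set E := star (ball x0 r) in fE mE0 *.
  have [mE Epos Eoo] := B1 _ fE.
  have sub : star B0 `<=` E by apply: st3 => //; rewrite B0E; case: Br.
  have mB0 : measurable (star B0) by rewrite sE; exact: measurable_mball.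
  (* As [star B0] lies in [E], both terms depend only on [f] cut to [E]: telescoping
     from these cut functions down to [star B0] keeps all norms over [E]. *)
  move=> f cf; pose F i := restr0 (f i) E.
  have cF i : cintegrable mu (F i) by exact: cintegrable_restr0.
  have FE i : restr0 (F i) (star B0) = restr0 (f i) (star B0).
    apply/funext => x; have [xs|xs] := pselect (star B0 x).
      by rewrite !restr0_in// /F restr0_in//; exact: sub.
    by rewrite !restr0_out.
  have vanish k z : mdist x0 z < 2 * r0 -> far_slot F (star B0) k k z = 0.
    move=> zr; rewrite /far_slot dfwithin restr0_out// sE => H; apply: H.
    by apply/ballP; exact: lt_le_trans rR.
  have far k := far_size hKc modw dini CK0 hK hm linT weakT repT r00
    (fun i => cintegrable_far_slot mB0 cF k i) (vanish k).
  have v0 := vol_gt0 hKc x0 r00.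
  have b0 : 0 <= size_cst mu Kc m CK x0 r0.
    by rewrite !(mulr_ge0, exprn_ge0, invr_ge0, vol_ge0)// ltW.
  have [Z nZ HZ] := telescope_bound linT mB0 cF b0
    (fun f _ => l1norm_ge0 mu f) (fun f E' mE' cf' => l1norm_restr0_le mE' cf') far.
  apply: negligibleS nZ => x /= /not_implyP[B0x nle]; apply: contrapT => nZx; apply: nle.
  have := HZ x x; rewrite -B0E => /(_ (conj B0x nZx) (conj B0x nZx)).
  rewrite mul0r subr0 (_ : (fun i => restr0 (F i) (star B0)) = (fun i => restr0 (f i) (star B0))).
    rewrite -lee_fin => /le_trans; apply.
    rewrite (eq_bigr (fun i => ((fine (mu E))^-1 * l1norm mu (F i))%:E)); last first.
      by move=> i _; rewrite avgE.
    rewrite prodEFin -EFinM lee_fin big_split /= prodr_const card_ord.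
    rewrite [leRHS]mulrA ler_wpM2r ?prodr_ge0// => [i _|]; first exact: l1norm_ge0.
    have V0 : 0 < fine (mu E) by rewrite fine_gt0// Epos.
    have VE : fine (mu E) <= Kc * C0' * vol mu x0 r0.
      have : fine (mu E) <= C0 * vol mu x0 r.
        rewrite -lee_fin fineK ?ge0_fin_numE// EFinM -(volE hKc).
        exact: mE0.
      move=> /le_trans; apply; rewrite [Kc * _]mulrC -mulrA ler_pM ?vol_ge0//.
        exact: le_trans C01.
      by rewrite le_max lexx orbT.
    have H : Kc ^+ 2 / vol mu x0 r0 <= Kc ^+ 3 * C0' * (fine (mu E))^-1.
      rewrite ler_pdivrMr// mulrAC ler_pdivlMr// [Kc ^+ 3]exprSr.
      by rewrite -[leRHS]mulrA -[leRHS]mulrA ler_pM2l ?exprn_gt0// mulrA.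
    rewrite /size_cst [leRHS](_ : _ = m%:R * (2 ^+ m * (CK * (Kc ^+ 3 * C0' * (fine (mu E))^-1) ^+ m))).
      rewrite ler_pM2l// ler_pM2l ?exprn_gt0// ler_pM2l//.
      rewrite lerXn2r// nnegrE; apply: ltW.
        by rewrite divr_gt0// exprn_gt0.
      by rewrite divr_gt0// mulr_gt0// exprn_gt0.
    by rewrite [in RHS]exprMn /C1; move: (_ ^+ m) (_ ^-1 ^+ m) => ? ?; ring.
  by apply/funext => i; rewrite FE.
- move=> B fB f cf.
  have full : star B = setT -> exists2 N, mu.-negligible N & forall x x',
      (B `\` N) x -> (B `\` N) x' ->
      ((cabs ((Text f x - Text (fun i => restr0 (f i) (star B)) x)
         - (Text f x' - Text (fun i => restr0 (f i) (star B)) x')))%:E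
        <= C2%:E * \prod_(i < m) sup_avg mu (balls_star mu) (f i) B)%E.
    move=> sT; exists set0; first exact: negligible_set0.
    move=> x x' _ _.
    rewrite (_ : (fun i => restr0 (f i) (star B)) = f); last first.
      by apply/funext => i; apply/funext => y; rewrite sT restr0_in.
    rewrite !subrr cabs0 mule_ge0// ?lee_fin ?(ltW C20)// prode_ge0// => i _.
    apply: le_ereal_sup_tmp; exists (avg mu (f i) B); first by exists B => //; split.
    have [mB _ _] := B1 _ fB.
    by rewrite avgE// lee_fin mulr_ge0 ?l1norm_ge0// invr_ge0 fine_ge0.
  case: (fB) => [bB|[_ BT]]; last first.
    apply: full; apply/seteqP; split => // x _.
    by apply: (ball_basis_sub_star hstar fB); rewrite BT; exact: I.
  have [x0 [r0 [r00 BE [[R0 rR sE]|sT]]]] := hconc _ bB; last exact: full.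
  have ms : measurable (star B) by rewrite sE; exact: measurable_mball.
  have vanish k z : mdist x0 z < 2 * r0 -> far_slot f (star B) k k z = 0.
    move=> zr; rewrite /far_slot dfwithin restr0_out// sE => H; apply: H.
    by apply/ballP; exact: lt_le_trans rR.
  have far k := far_osc hKc modw dini CK0 hK hm linT weakT repT r00
    (fun i => cintegrable_far_slot ms cf k i) (vanish k).
  have b0 : 0 <= osc_cst Kc m w CK.
    by rewrite -(pmulr_rge0 _ m0) /osc_cst mulrA ltW.
  have [Z nZ HZ] := telescope_bound linT ms cf b0
    (fun f => @sup_avgr_ge0 _ _ _ mu _ hKc x0 r0 r00 f)
    (fun f E' mE' cf' => @sup_avgr_restr _ _ _ mu _ hKc x0 r0 r00 f E' mE' cf') far.
  exists Z => // x x' Bx Bx'; rewrite BE in Bx Bx'.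
  have := HZ x x' Bx Bx'; rewrite mul1r.
  rewrite (eq_bigr (fun i => (sup_avgr mu x0 r0 (f i))%:E)); last first.
    by move=> i _; rewrite BE (sup_avgE hKc).
  by rewrite prodEFin -EFinM lee_fin /C2 /osc_cst !mulrA.
Qed.
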